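(* Let $(\Omega,m)$ be a $\sigma$-finite measure space such that $L^2(\Omega)$ is separable, and let $\mathcal H$ be a separable Hilbert space. Suppose $\mathcal D\subseteq L^\infty(\Omega)$ is a determining set for $L^1(\Omega)$, that $W\subseteq L^2(\Omega,\mathcal H)$ is a multiplicatively invariant space with respect to $\mathcal D$, and that $J$ is the corresponding range function. Let $U:W\to L^2(\Omega,\mathcal H)$ be a bounded linear operator. Then the following are equivalent. (1) $U$ is multiplication preserving with respect to $\mathcal D$. (2) $U$ is multiplication preserving with respect to $L^\infty(\Omega)$. (3) There exists a measurable range operator $R$ on $J$ such that for all $\phi\in W$, $$ (U\phi)(\omega)=R(\omega)(\phi(\omega))\quad\text{for a.e. }\omega\in\Omega. \qquad ( * )$$ Conversely, given a measurable range operator $R$ on $J$ with $\operatorname{ess\,sup}_{\omega\in\Omega}\|R(\omega)\|<\infty$, there is a bounded multiplication preserving (with respect to $\mathcal D$) operator $U:W\to L^2(\Omega,\mathcal H)$ such that $( * )$ holds for all $\phi\in W$. The correspondence between $U$ and $R$ is one to one under the convention that range operators are identified if they are equal a.e. Moreover, $\|U\|=\operatorname{ess\,sup}_{\omega\in\Omega}\|R(\omega)\|$.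
   Context: $L^2(\Omega,\mathcal H)$ is the Hilbert space of measurable $\phi:\Omega\to\mathcal H$ with $\int_\Omega\|\phi(\omega)\|^2\,dm(\omega)<\infty$, with inner product $\langle\phi,\psi\rangle=\int_\Omega\langle\phi(\omega),\psi(\omega)\rangle\,dm(\omega)$. A subset $\mathcal D\subseteq L^\infty(\Omega)$ is a determining set for $L^1(\Omega)$ if for every $f\in L^1(\Omega)$, $\int_\Omega fg\,dm=0$ for all $g\in\mathcal D$ implies $f=0$. A closed subspace $W\subseteq L^2(\Omega,\mathcal H)$ is multiplicatively invariant with respect to $\mathcal D$ if $g\phi\in W$ for all $\phi\in W$, $g\in\mathcal D$. A range function is a map $J:\Omega\to\{\text{closed subspaces of }\mathcal H\}$; $P_J(\omega)$ denotes the orthogonal projection of $\mathcal H$ onto $J(\omega)$; $J$ is measurable if $\omega\mapsto\langle P_J(\omega)a,b\rangle$ is measurable for all $a,b\in\mathcal H$. It is known (Bownik and Ross) that a closed subspace $W$ is multiplicatively invariant with respect to $\mathcal D$ if and only if it is so with respect to $L^\infty(\Omega)$, if and only if there is a measurable range function $J$ with $W=\{\phi\in L^2(\Omega,\mathcal H):\phi(\omega)\in J(\omega)\text{ for a.e. }\omega\}$; such $J$ is unique up to a.e. equality and is called the range function corresponding to $W$. A bounded linear operator $U:W\to L^2(\Omega,\mathcal H)$ is multiplication preserving with respect to a set $\mathcal E\subseteq L^\infty(\Omega)$ (here $\mathcal E=\mathcal D$ or $\mathcal E=L^\infty(\Omega)$) if $U(g\phi)(\omega)=g(\omega)U(\phi)(\omega)$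 a.e., for all $g\in\mathcal E$, $\phi\in W$. A range operator on $J$ is a map $R$ assigning to (almost) every $\omega\in\Omega$ a bounded linear operator $R(\omega):J(\omega)\to\mathcal H$. It is measurable if $\omega\mapsto\langle R(\omega)P_J(\omega)a,b\rangle$ is measurable for all $a,b\in\mathcal H$. *)

(* Defs.v *)
From HB Require Import structures.
From mathcomp Require Import all_boot all_order all_algebra.
From mathcomp Require Import complex.
From mathcomp Require Import all_classical all_reals all_analysis.

Set Implicit Arguments.
Unset Strict Implicit.
Unset Printing Implicit Defensive.

Import Order.TTheory GRing.Theory Num.Theory.
Import numFieldNormedType.Exports.

Local Open Scope classical_set_scope.
Local Open Scope ring_scope.

(* Scalars are complex: R is a realType and R[i] the field of scalars.
   A complex Hilbert space is a complete normed module H over R[i] with a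
   positive definite Hermitian form (linear in the first argument,
   conjugate-linear in the second) inducing its norm.

   Elements of the Lebesgue spaces are represented by measurable functions;
   equality in these spaces is equality mu-a.e. *)

Section hilbert.
Context {R : realType}.

Definition induces_norm (H : completeNormedModType R[i])
    (dot : {dot H for @Num.conj R[i]}) : Prop :=
  forall x : H, dot x x = `|x| ^+ 2.

Definition separable (T : topologicalType) : Prop :=
  exists2 A : set T, countable A & dense A.

(* The norm of a module over R[i] takes its values in R[i]. *)
Definition rnorm (V : normedModType R[i]) (v : V) : R := complex.Re `|v|.

Definition closed_subspace (V : normedModType R[i]) (S : set V) : Prop :=
  submod_closed [in S] /\ closed S.

Definition bounded_linear_on (V V' : normedModType R[i]) (S : set V)
    (f : V -> V') : Prop :=
  (forall (a : R[i]) u v, S u -> S v -> f (a *: u + v) = a *: f u + f v) /\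
  (exists M : R, forall v, S v -> rnorm (f v) <= M * rnorm v).

Definition opnorm_on (V V' : normedModType R[i]) (S : set V)
    (f : V -> V') : \bar R :=
  ereal_sup [set (rnorm (f v))%:E | v in [set v | S v /\ rnorm v <= 1]].

Definition orthproj (H : completeNormedModType R[i])
    (dot : {dot H for @Num.conj R[i]}) (S : set H) (x : H) : H :=
  xget 0 [set p | S p /\ forall y, S y -> dot (x - p) y = 0].

End hilbert.

Section lebesgue_spaces.
Context {d : measure_display} {Omega : measurableType d} {R : realType}.
Variable mu : {measure set Omega -> \bar R}.
Implicit Type V : normedModType R[i].

Definition borel_measurable V (f : Omega -> V) : Prop :=
  measurable_fun [set: Omega] (f : Omega -> g_sigma_algebraType (@open V)).

Definition L1 : set (Omega -> R[i]^o) :=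
  [set f | borel_measurable f /\ (\int[mu]_w (rnorm (f w))%:E < +oo)%E].

Definition L2 V : set (Omega -> V) :=
  [set phi | borel_measurable phi /\
             (\int[mu]_w (rnorm (phi w) ^+ 2)%:E < +oo)%E].

Definition Linfty : set (Omega -> R[i]^o) :=
  [set g | borel_measurable g /\
           exists M : R, {ae mu, forall w, rnorm (g w) <= M}].

Definition Cintegral (f : Omega -> R[i]^o) : R[i] :=
  Complex (\int[mu]_w complex.Re (f w)) (\int[mu]_w complex.Im (f w)).

Definition L2norm V (phi : Omega -> V) : \bar R :=
  Lnorm mu 2%:E (fun w => (rnorm (phi w))%:E).

Definition L2_separable : Prop :=
  exists A : set (Omega -> R[i]^o),
    [/\ countable A, A `<=` L2 (V := R[i]^o) &
        forall f, L2 (V := R[i]^o) f -> forall e : R, 0 < e ->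
          exists2 g, A g & (L2norm (V := R[i]^o) (f - g)%R < e%:E)%E].

Definition determining (D : set (Omega -> R[i]^o)) : Prop :=
  forall f, L1 f ->
    (forall g, D g -> Cintegral (fun w => f w * g w) = 0) ->
    {ae mu, forall w, f w = 0}.

Section operators.
Variable H : completeNormedModType R[i].
Implicit Types (W : set (Omega -> H)) (U : (Omega -> H) -> (Omega -> H)).

(* The last clause makes W saturated for equality a.e. *)
Definition closed_subspace_L2 W : Prop :=
  [/\ W `<=` L2 (V := H),
      submod_closed [in W] &
      forall phi, L2 phi ->
        (forall e : R, 0 < e ->
           exists2 psi, W psi & (L2norm (phi - psi)%R < e%:E)%E) -> W phi].

Definition mult_invariant (D : set (Omega -> R[i]^o)) W : Prop :=
  closed_subspace_L2 W /\
  forall g phi, D g -> W phi -> W (fun w => g w *: phi w).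

(* A bounded linear operator from W to L^2(Omega, H), given on
   representatives: the values of U outside W are irrelevant. *)
Definition bounded_operator W U : Prop :=
  [/\ forall phi, W phi -> L2 (U phi),
      forall phi psi, W phi -> W psi ->
        {ae mu, forall w, phi w = psi w} ->
        {ae mu, forall w, U phi w = U psi w},
      forall (a : R[i]) phi psi, W phi -> W psi ->
        {ae mu, forall w, U (a *: phi + psi) w = a *: U phi w + U psi w} &
      exists M : R, forall phi, W phi ->
        (L2norm (U phi) <= M%:E * L2norm phi)%E].

Definition operator_norm W U : \bar R :=
  ereal_sup [set L2norm (U phi) |
             phi in [set phi | W phi /\ (L2norm phi <= 1)%E]].

Definition eq_operators W U U' : Prop :=
  forall phi, W phi -> {ae mu, forall w, U phi w = U' phi w}.

Definition mult_preserving (E : set (Omega -> R[i]^o)) W U : Prop :=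
  forall g phi, E g -> W phi ->
    {ae mu, forall w, U (fun w' => g w' *: phi w') w = g w *: U phi w}.

Variable dot : {dot H for @Num.conj R[i]}.

Implicit Types (J : Omega -> set H) (T : Omega -> H -> H).

Definition range_function J : Prop := forall w, closed_subspace (J w).

Definition measurable_range_function J : Prop :=
  range_function J /\
  forall a b : H,
    borel_measurable (fun w => dot (orthproj dot (J w) a) b : R[i]^o).

Definition corresponding_range_function W J : Prop :=
  measurable_range_function J /\
  W = [set phi | L2 phi /\ {ae mu, forall w, J w (phi w)}].

(* Only the restriction of T w to J w is meaningful. *)
Definition measurable_range_operator J T : Prop :=
  {ae mu, forall w, bounded_linear_on (J w) (T w)} /\
  forall a b : H,
    borel_measurable (fun w => dot (T w (orthproj dot (J w) a)) b : R[i]^o).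

Definition eq_range_operators J T T' : Prop :=
  {ae mu, forall w, forall v, J w v -> T w v = T' w v}.

(* The library's L^oo-norm is the essential supremum of the absolute value,
   except that it is 0 instead of -oo when mu is the zero measure. *)
Definition ess_sup_opnorm J T : \bar R :=
  Lnorm mu +oo%E (fun w => opnorm_on (J w) (T w)).

Definition represents W U T : Prop :=
  forall phi, W phi -> {ae mu, forall w, U phi w = T w (phi w)}.

End operators.
End lebesgue_spaces.

(* Main.v *)
(** Let eta > 0 be square integrable and bounded, (a_n) dense in H and P(w) the
    projection onto J(w); the functions phi_n = eta P a_n lie in W.

    (1) => (2). For phi in W and psi in L^2, Radon-Nikodym applied to the complex
    measure E |-> <U(1_E phi), psi> gives f in L^1 with <U(h phi), psi> = \int h f
    for all h in L^oo. If U commutes with D, then f - <U phi(.), psi(.)> is annihilated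
    by D, hence is 0; so <U(h phi) - h U phi, psi> = 0, and one takes
    psi = U(h phi) - h U phi.

    (2) => (3). Commuting with indicator functions turns |U phi|_2 <= M |phi|_2 into
    the pointwise bound |U phi(w)| <= M |phi(w)| a.e. Applied to the differences and
    to the rational linear combinations of the phi_n, it shows that off one null set
    P(w) a_n |-> U phi_n(w) / eta(w) extends to a bounded linear operator R(w) on
    J(w); applied to eta phi - phi_n, it shows that U phi = R phi a.e.

    The same pointwise bound gives |U| >= ess sup |R|, and the phi_n determine R.

    As H is separable, f : Omega -> H is Borel as soon as all the |f - c|, c in H, are
    measurable, and these are infima of countably many known measurable functions. *)

Require Import Defs.
From HB Require Import structures.
From mathcomp Require Import all_boot all_order all_algebra.
From mathcomp Require Import complex.
From mathcomp Require Import all_classical all_reals all_analysis.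
From mathcomp Require Import measurable_realfun ess_sup_inf.
From mathcomp Require Import ring lra.

Set Implicit Arguments.
Unset Strict Implicit.
Unset Printing Implicit Defensive.

Import Order.TTheory GRing.Theory Num.Theory.
Import numFieldNormedType.Exports HBNNSimple.

Local Open Scope classical_set_scope.
Local Open Scope ring_scope.

(** * Norms and projections in a complex Hilbert space *)

Section rnorm_theory.
Context {R : realType}.
Implicit Types V : normedModType R[i].

(** A determining set can only be tested against [L1], whereas [h |-> <U(h phi), psi>] is at first
    just a functional of [h]. The bound [|<U(h phi), psi>|^2 <= M^2 |psi|^2 \int |h|^2 |phi|^2]
    makes it countably additive and absolutely continuous, hence given by a density. Operators act
    on representatives: an inequality between [U phi] and [phi] fails on a null set depending on
    [phi], so only countably many can be imposed at once. The [P(w) a_n] are dense in [J(w)] but not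
    closed under linear combinations. Linearity is therefore stated approximately: with
    [F_n = U phi_n / eta] and [q_j] dense in the scalars, [|F_k - (q_j F_n + F_m)| <= M |P a_k -
    (q_j P a_n + P a_m)|] for all indices. The extension at [v] is the only [y] with
    [|y - F_n| <= M |v - P a_n|] for all [n]; since [U phi(w)] satisfies these inequalities for
    [v = phi(w)], it is the value of the extension there. The weight [eta] is needed because a
    constant vector is not square integrable on a space of infinite measure; its boundedness keeps
    [eta phi] in [W], its positivity allows division. *)

Lemma norm_rnorm V (v : V) : `|v| = real_complex R (rnorm v).
Proof. by rewrite /rnorm RRe_real ?normr_real. Qed.

Lemma rnorm_ge0 V (v : V) : 0 <= rnorm v.
Proof. by rewrite -lecR -norm_rnorm normr_ge0. Qed.

Lemma rnorm0 V : rnorm (0 : V) = 0.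
Proof. by rewrite /rnorm normr0. Qed.

Lemma rnorm_eq0 V (v : V) : rnorm v = 0 -> v = 0.
Proof. by move=> v0; apply/normr0_eq0; rewrite norm_rnorm v0. Qed.

Lemma rnormN V (v : V) : rnorm (- v) = rnorm v.
Proof. by rewrite /rnorm normrN. Qed.

Lemma rnormC V (u v : V) : rnorm (u - v) = rnorm (v - u).
Proof. by rewrite -rnormN opprB. Qed.

Lemma rnormD V (u v : V) : rnorm (u + v) <= rnorm u + rnorm v.
Proof. by rewrite -lecR rmorphD/= -!norm_rnorm ler_normD. Qed.

Lemma rnorm_dist V (u v w : V) : rnorm (u - w) <= rnorm (u - v) + rnorm (v - w).
Proof. by apply: le_trans (rnormD _ _); rewrite addrA subrK. Qed.

Lemma rnormZ V (a : R[i]) (v : V) : rnorm (a *: v) = rnorm (a : R[i]^o) * rnorm v.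
Proof.
by apply: complexI; rewrite rmorphM/= -!norm_rnorm normrZ.
Qed.

Lemma rnormE (z : R[i]^o) : rnorm z = Num.sqrt (complex.Re z ^+ 2 + complex.Im z ^+ 2).
Proof. by case: z. Qed.

Lemma sqr_rnorm (z : R[i]^o) : rnorm z ^+ 2 = complex.Re z ^+ 2 + complex.Im z ^+ 2.
Proof. by rewrite rnormE sqr_sqrtr// addr_ge0// sqr_ge0. Qed.

Lemma rnorm_real (r : R) : rnorm (real_complex R r : R[i]^o) = `|r|.
Proof. by rewrite rnormE /= expr0n addr0 sqrtr_sqr. Qed.

Lemma rnorm_i : rnorm (Complex 0 1 : R[i]^o) = 1.
Proof. by rewrite rnormE/= expr0n expr1n add0r sqrtr1. Qed.

Lemma rnormM (a b : R[i]^o) : rnorm (a * b : R[i]^o) = rnorm a * rnorm b.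
Proof. exact: (@rnormZ (R[i]^o)). Qed.

Lemma rnorm_le_ReIm (z : R[i]^o) : rnorm z <= `|complex.Re z| + `|complex.Im z|.
Proof.
rewrite -(@ler_pXn2r _ 2)// ?nnegrE ?rnorm_ge0 ?addr_ge0// sqr_rnorm.
have := normr_ge0 (complex.Re z); have := normr_ge0 (complex.Im z).
rewrite -[complex.Re z ^+ 2]real_normK ?num_real//.
rewrite -[complex.Im z ^+ 2]real_normK ?num_real//; nra.
Qed.

Lemma Re_le_rnorm (z : R[i]^o) : `|complex.Re z| <= rnorm z.
Proof.
rewrite -(@ler_pXn2r _ 2)// ?nnegrE ?rnorm_ge0// sqr_rnorm.
by rewrite real_normK ?num_real// lerDl sqr_ge0.
Qed.

Lemma Im_le_rnorm (z : R[i]^o) : `|complex.Im z| <= rnorm z.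
Proof.
rewrite -(@ler_pXn2r _ 2)// ?nnegrE ?rnorm_ge0// sqr_rnorm.
by rewrite real_normK ?num_real// lerDr sqr_ge0.
Qed.

(** Balls have radii in [R[i]]; a positive element of [R[i]] is real, so its real part serves as a
    radius in [R]. *)
Lemma open_rnorm V (U : set V) (x : V) : open U -> U x ->
  exists2 e : R, 0 < e & forall y, rnorm (y - x) < e -> U y.
Proof.
move=> oU Ux; have /nbhs_ballP[e /= e0 eU] : nbhs x U by exact: open_nbhs_nbhs.
have er : e = real_complex R (complex.Re e) by rewrite RRe_real// gtr0_real.
exists (complex.Re e); first by rewrite -ltcR -er.
by move=> y yx; apply: eU; rewrite -ball_normE/= norm_rnorm rnormC er ltcR.
Qed.

Lemma open_rball V (x : V) (e : R) : open [set y | rnorm (y - x) < e].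
Proof.
rewrite openE => y /= yx; rewrite /interior.
apply/nbhs_ballP; exists (real_complex R (e - rnorm (y - x))) => /=.
  by rewrite ltcR subr_gt0.
move=> z; rewrite -ball_normE/= norm_rnorm ltcR ltrBrDr => zy.
by apply: le_lt_trans zy; rewrite -(rnormC z); apply: rnorm_dist.
Qed.

Lemma closed_rnorm V (S : set V) (x : V) : closed S ->
  (forall e : R, 0 < e -> exists2 y, S y & rnorm (y - x) < e) -> S x.
Proof.
move=> cS Sx; apply: contrapT => nSx.
have [|e e0 eS] := open_rnorm (closed_openC cS) (x := x); first exact: nSx.
by have [y Sy /eS] := Sx _ e0.
Qed.

(** A sequence rather than a countable set: indices in [nat] let [ae_foralln] merge the exceptional
    null sets. *)
Definition dense_seq V (a : nat -> V) :=
  forall x (e : R), 0 < e -> exists n, rnorm (x - a n) < e.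

Lemma separable_dense_seq V : separable V -> exists a : nat -> V, dense_seq a.
Proof.
move=> [A cA dA].
have A0 : A !=set0.
  by have [x [_ Ax]] := dA setT (ex_intro _ 0 I) openT; exists x.
have [a aA] : exists a : nat -> V, A = range a.
  have /pfcard_geP[A00|[f]] := cA; first by rewrite A00 in A0; case: A0.
  by exists f; rewrite image_eq.
exists a => x e e0.
have /dA/(_ (open_rball x e)) : [set y | rnorm (y - x) < e] !=set0.
  by exists x => /=; rewrite subrr rnorm0.
by rewrite aA => -[y [/= yx [n _ ny]]]; exists n; rewrite ny rnormC.
Qed.

Lemma complex_dense_seq : exists q : nat -> R[i]^o, dense_seq q.
Proof.
pose f (pq : rat * rat) : R[i]^o := Complex (ratr pq.1) (ratr pq.2).
(* Codes that decode to nothing get the value at [(0, 0)]; only surjectivity onto the rational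
   points matters. *)
exists (fun n => f (odflt (0, 0) (unpickle n))) => -[x y] e e0.
have rat_near (r : R) : exists s : rat, `|r - ratr s| < e / 2.
  have [|s /=] := @rat_in_itvoo R (r - e / 2) (r + e / 2); first by lra.
  by rewrite in_itv/= => /andP[s1 s2]; exists s; rewrite ltr_norml; lra.
have [[s xs] [t yt]] := (rat_near x, rat_near y).
exists (pickle (s, t)); rewrite pickleK /f/=.
by apply: le_lt_trans (rnorm_le_ReIm _) _ => /=; lra.
Qed.

Lemma complete_rnorm (V : completeNormedModType R[i]) (u : nat -> V) :
  (forall e : R, 0 < e -> exists N, forall m n, (N <= m)%N -> (N <= n)%N ->
     rnorm (u m - u n) < e) ->
  exists l, forall e : R, 0 < e -> exists N, forall n, (N <= n)%N ->
    rnorm (u n - l) < e.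
Proof.
move=> cu.
have /cauchy_cvg /cvg_ex[l ul] : cauchy (u @ \oo).
  apply: cauchy_exP => e e0.
  have er : e = real_complex R (complex.Re e) by rewrite RRe_real// gtr0_real.
  have e0' : 0 < complex.Re e by rewrite -ltcR -er.
  have [N uN] := cu _ e0'.
  exists (u N); exists N => // n /= Nn.
  by rewrite -ball_normE/= norm_rnorm er ltcR; exact: uN.
exists l => e e0.
have /cvgrPdist_lt/(_ (real_complex R e)) := ul.
rewrite ltcR => /(_ e0)[N _ uN]; exists N => n Nn.
by have := uN n Nn; rewrite /= norm_rnorm ltcR rnormC.
Qed.

End rnorm_theory.

(** * Real part of the inner product and orthogonal projections *)

Section hilbert_theory.
Context {R : realType} (H : completeNormedModType R[i]).
Variable dot : {dot H for @Num.conj R[i]}.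

Lemma dotDl x y z : dot (x + y) z = dot x z + dot y z.
Proof. by rewrite linearDl. Qed.

Lemma dotZl (a : R[i]) x y : dot (a *: x) y = a * dot x y.
Proof. by rewrite linearZl_LR. Qed.

Lemma dot_conj x y : dot y x = conjc (dot x y).
Proof. by have := hermC dot y x; rewrite /= mul1r. Qed.

Lemma dotZr (a : R[i]) x y : dot x (a *: y) = conjc a * dot x y.
Proof. by rewrite linearZr_LR. Qed.

Lemma dot0l y : dot 0 y = 0.
Proof. by rewrite linear0l. Qed.

Definition redot x y := complex.Re (dot x y).

Lemma redotC x y : redot x y = redot y x.
Proof. by rewrite /redot dot_conj; case: (dot y x). Qed.

Lemma redotDl x y z : redot (x + y) z = redot x z + redot y z.
Proof. by rewrite /redot dotDl; case: (dot x z) (dot y z) => ? ? []. Qed.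

Lemma redotZl (r : R) x y : redot (real_complex R r *: x) y = r * redot x y.
Proof. by rewrite /redot dotZl; case: (dot x y) => a b /=; rewrite mul0r subr0. Qed.

Lemma redotDr x y z : redot x (y + z) = redot x y + redot x z.
Proof. by rewrite redotC redotDl !(redotC x). Qed.

Lemma redotZr (r : R) x y : redot x (real_complex R r *: y) = r * redot x y.
Proof. by rewrite redotC redotZl redotC. Qed.

Lemma redotNl x y : redot (- x) y = - redot x y.
Proof. by rewrite -scaleN1r -[-1](rmorphN1 (real_complex R)) redotZl mulN1r. Qed.

Lemma Im_dot x y : complex.Im (dot x y) = redot x (Complex 0 1 *: y).
Proof. by rewrite /redot dotZr; case: (dot x y) => a b /=; lra. Qed.

Hypothesis dotE : induces_norm dot.

Lemma redotxx x : redot x x = rnorm x ^+ 2.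
Proof.
by rewrite /redot dotE norm_rnorm -rmorphXn.
Qed.

Lemma sqr_rnormD x y : rnorm (x + y) ^+ 2 = rnorm x ^+ 2 + 2 * redot x y + rnorm y ^+ 2.
Proof.
by rewrite -!redotxx redotDl !redotDr (redotC y x); lra.
Qed.

Lemma sqr_rnormB x y : rnorm (x - y) ^+ 2 = rnorm x ^+ 2 - 2 * redot x y + rnorm y ^+ 2.
Proof. by rewrite sqr_rnormD rnormN redotC redotNl redotC; lra. Qed.

(** Expand [|s^-1 x + s y|^2 >= 0] and [|s^-1 x - s y|^2 >= 0] with [s^2 = t]; a factor 1/2 is given
    away. The free parameter [t] makes this as useful as Cauchy-Schwarz, and it integrates term by
    term. *)
Lemma redot_le x y (t : R) : 0 < t ->
  `|redot x y| <= t * rnorm y ^+ 2 + t^-1 * rnorm x ^+ 2.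
Proof.
move=> t0; set s := Num.sqrt t.
have s0 : 0 < s by rewrite sqrtr_gt0.
have s2 : s ^+ 2 = t by rewrite sqr_sqrtr// ltW.
have := sqr_ge0 (rnorm (real_complex R s^-1 *: x + real_complex R s *: y)).
have := sqr_ge0 (rnorm (real_complex R s^-1 *: x - real_complex R s *: y)).
rewrite sqr_rnormB sqr_rnormD redotZl redotZr !rnormZ !rnorm_real.
rewrite !exprMn !real_normK ?num_real// exprVn s2 mulrA mulVf ?gt_eqF// mul1r.
have := mulr_ge0 (ltW t0) (sqr_ge0 (rnorm y)).
have := mulr_ge0 (ltW (_ : 0 < t^-1)) (sqr_ge0 (rnorm x)).
rewrite invr_gt0 => /(_ t0).
by rewrite ler_norml; lra.
Qed.

Lemma parallelogram (x y : H) :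
  rnorm (x + y) ^+ 2 + rnorm (x - y) ^+ 2 = 2 * (rnorm x ^+ 2 + rnorm y ^+ 2).
Proof. by rewrite sqr_rnormB sqr_rnormD; lra. Qed.

Section projection.
Variable S : set H.
Hypothesis cS : closed_subspace S.

Lemma closed_subspace0 : S 0.
Proof. by have [[/set_mem]] := cS. Qed.

Lemma closed_subspaceDZ (a : R[i]) u v : S u -> S v -> S (a *: u + v).
Proof.
by move=> Su Sv; have [[_ SDZ] _] := cS; apply/set_mem/SDZ; exact: mem_set.
Qed.

Lemma closed_subspaceZ (a : R[i]) u : S u -> S (a *: u).
Proof.
by move=> Su; rewrite -[_ *: _]addr0; apply: closed_subspaceDZ => //; exact: closed_subspace0.
Qed.

Lemma closed_subspaceD u v : S u -> S v -> S (u + v).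
Proof. by move=> Su /(closed_subspaceDZ 1 Su); rewrite scale1r. Qed.

Lemma closed_subspaceB u v : S u -> S v -> S (u - v).
Proof. by move=> Su Sv; rewrite addrC -scaleN1r; exact: closed_subspaceDZ. Qed.

(** By the parallelogram law a minimising sequence is Cauchy, and its limit stays in [S] because [S]
    is closed. *)
Lemma dist_minimizer x : exists2 p, S p & forall y, S y -> rnorm (x - p) <= rnorm (x - y).
Proof.
pose E := [set rnorm (x - y) ^+ 2 | y in S].
have E0 : E !=set0 by exists (rnorm (x - 0) ^+ 2); exists 0 => //; exact: closed_subspace0.
have lbE : lbound E 0 by move=> _ [y _ <-]; exact: sqr_ge0.
have infE : has_inf E by split=> //; exists 0.
set d := inf E.
have d_le y : S y -> d <= rnorm (x - y) ^+ 2.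
  by move=> Sy; apply: ge_inf; [exists 0|exists y].
have near_d (e : R) : 0 < e -> exists2 y, S y & rnorm (x - y) ^+ 2 < d + e.
  by move=> e0; have [_ [y Sy <-] yd] := inf_adherent e0 infE; exists y.
pose u n := sval (cid2 (near_d (n.+1%:R^-1) (ltac:(by rewrite invr_gt0)))).
have Su n : S (u n) by rewrite /u; case: cid2.
have ud n : rnorm (x - u n) ^+ 2 < d + n.+1%:R^-1 by rewrite /u; case: cid2.
(* the midpoint of [u m] and [u n] lies in [S] *)
have udist m n : rnorm (u m - u n) ^+ 2 <= 2 * (m.+1%:R^-1 + n.+1%:R^-1).
  have := parallelogram (x - u m) (x - u n).
  have -> : x - u m - (x - u n) = u n - u m by rewrite opprB addrC addrA subrK.
  have -> : x - u m + (x - u n) =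
      real_complex R 2 *: (x - real_complex R 2^-1 *: (u m + u n)).
    rewrite scalerBr scalerA -rmorphM mulfV ?pnatr_eq0// scale1r.
    by rewrite rmorph_nat scaler_nat mulr2n opprD addrACA.
  rewrite rnormZ rnorm_real ger0_norm// exprMn (rnormC (u n)).
  have := d_le _ (closed_subspaceZ (real_complex R 2^-1) (closed_subspaceD (Su m) (Su n))).
  move: (ud m) (ud n); rewrite -natrX.
  by move: (m.+1%:R^-1) (n.+1%:R^-1) => a b; lra.
have small (e : R) : 0 < e -> exists N, forall n, (N <= n)%N -> n.+1%:R^-1 < e.
  move=> e0; exists (Num.bound e^-1) => n Nn.
  rewrite invf_plt ?posrE//; apply: lt_le_trans (archi_boundP _) _.
    by rewrite invr_ge0 ltW.
  by rewrite ler_nat leqW.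
have [|p up] := complete_rnorm (u := u).
  move=> e e0; have [|N Ne] := small (e ^+ 2 / 4).
    by rewrite divr_gt0// exprn_gt0.
  exists N => m n /Ne Nm /Ne Nn; rewrite -(@ltr_pXn2r _ 2)// ?nnegrE ?rnorm_ge0 ?ltW//.
  move: (udist m n) Nm Nn.
  by move: (m.+1%:R^-1) (n.+1%:R^-1) => a b; lra.
have Sp : S p.
  apply: closed_rnorm; first by case: cS.
  by move=> e /up[N /(_ N (leqnn _))]; exists (u N).
exists p => // y Sy; apply/ler_addgt0Pr => e e0.
have [N1 N1e] := up _ (divr_gt0 e0 (ltr0n _ 2)).
(* The tolerance is [(e / 2)^2] because [|x - y|^2 + (e / 2)^2 <= (|x - y| + e / 2)^2]. *)
have [N2 N2e] := small _ (exprn_gt0 2 (divr_gt0 e0 (ltr0n _ 2))).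
pose n := maxn N1 N2.
have {}N1e := N1e n (leq_maxl _ _); have {}N2e := N2e n (leq_maxr _ _).
have : rnorm (x - u n) < rnorm (x - y) + e / 2.
  rewrite -(@ltr_pXn2r _ 2)// ?nnegrE ?rnorm_ge0 ?addr_ge0 ?rnorm_ge0 ?divr_ge0 ?ltW//.
  have := mulr_ge0 (rnorm_ge0 (x - y)) (ltW e0).
  move: (ud n) (d_le _ Sy) N2e; rewrite sqrrD -[_ *+ 2]mulr_natr.
  by move: (n.+1%:R^-1) => a; lra.
by have := rnorm_dist x (u n) p; lra.
Qed.

(** The nearest point satisfies the condition by first variation: moving it by [t y] inside [S]
    cannot shorten the distance, for any real [t]. *)
Lemma orthprojP x :
  S (orthproj dot S x) /\ forall y, S y -> dot (x - orthproj dot S x) y = 0.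
Proof.
rewrite /orthproj; case: xgetP => [p _ //|noproj].
exfalso; have [p Sp pmin] := dist_minimizer x; apply: (noproj p); split=> //.
have re0 y : S y -> redot (x - p) y = 0.
  move=> Sy.
  have ineq (t : R) : 0 <= t ^+ 2 * rnorm y ^+ 2 - 2 * t * redot (x - p) y.
    have := pmin (p + real_complex R t *: y)
      (closed_subspaceD Sp (closed_subspaceZ _ Sy)).
    rewrite opprD addrA -(@ler_pXn2r _ 2)// ?nnegrE ?rnorm_ge0//.
    rewrite (sqr_rnormB (x - p)) redotZr rnormZ rnorm_real exprMn.
    rewrite real_normK ?num_real//; lra.
  set r := redot _ _ in ineq *; set n2 := rnorm y ^+ 2 in ineq.
  have n20 : 0 <= n2 by exact: sqr_ge0.
  (* The quadratic is minimal at [r / n2]; adding 1 to the denominator avoids the case [y = 0] and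
     still gives a negative value unless [r = 0]. *)
  have := ineq (r / (n2 + 1)).
  have n1 : 0 < n2 + 1 by lra.
  have -> : (r / (n2 + 1)) ^+ 2 * n2 - 2 * (r / (n2 + 1)) * r =
            - (r ^+ 2 * (n2 + 2) / (n2 + 1) ^+ 2) by field; lra.
  rewrite oppr_ge0 pmulr_lle0 ?invr_gt0 ?exprn_gt0//.
  rewrite pmulr_lle0; last by lra.
  by move=> r2; apply/eqP; rewrite -sqrf_eq0 eq_le r2 sqr_ge0.
(* The imaginary part is the real part taken against [i y], which is again in [S]. *)
move=> y Sy; apply/eqP; rewrite eq_complex Im_dot.
by apply/andP; split; apply/eqP; apply: re0 => //; exact: closed_subspaceZ.
Qed.

Lemma orthprojS x : S (orthproj dot S x).
Proof. by have [] := orthprojP x. Qed.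

(** [orthproj] is defined by choice; uniqueness reduces each identity about it to exhibiting the
    right candidate. *)
Lemma orthproj_unique x p : S p -> (forall y, S y -> dot (x - p) y = 0) ->
  orthproj dot S x = p.
Proof.
move=> Sp xp; have [SP xP] := orthprojP x.
apply/eqP; rewrite -subr_eq0; apply/eqP/rnorm_eq0/eqP; rewrite -sqrf_eq0 -redotxx.
set P := orthproj _ _ _ in SP xP *.
have SPp : S (P - p) by exact: closed_subspaceB.
have -> : redot (P - p) (P - p) = redot (x - p) (P - p) - redot (x - P) (P - p).
  by rewrite -redotNl -redotDl opprB [in RHS]addrC addrA subrK.
by rewrite /redot xp// xP// subrr.
Qed.

Lemma orthproj_id x : S x -> orthproj dot S x = x.
Proof. by move=> Sx; apply: orthproj_unique => // y _; rewrite subrr dot0l. Qed.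

Lemma orthprojDZ (a : R[i]) x y :
  orthproj dot S (a *: x + y) = a *: orthproj dot S x + orthproj dot S y.
Proof.
have [[Sx xP] [Sy yP]] := (orthprojP x, orthprojP y).
apply: orthproj_unique; first exact: closed_subspaceDZ.
move=> z Sz; rewrite opprD addrACA -scalerBr dotDl dotZl xP// yP//.
by rewrite mulr0 addr0.
Qed.

Lemma rnorm_orthproj x : rnorm (orthproj dot S x) <= rnorm x.
Proof.
have [SP xP] := orthprojP x; set P := orthproj _ _ _ in SP xP *.
rewrite -(@ler_pXn2r _ 2)// ?nnegrE ?rnorm_ge0//.
have := sqr_rnormD (x - P) P; rewrite subrK /redot xP// => ->.
by rewrite mulr0 addr0 lerDr sqr_ge0.
Qed.

Lemma orthprojB x y : orthproj dot S (x - y) = orthproj dot S x - orthproj dot S y.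
Proof. by rewrite addrC -scaleN1r orthprojDZ scaleN1r addrC. Qed.

Lemma orthproj_lip x y :
  rnorm (orthproj dot S x - orthproj dot S y) <= rnorm (x - y).
Proof. by rewrite -orthprojB; exact: rnorm_orthproj. Qed.

End projection.
End hilbert_theory.

(** * Borel measurability of vector-valued functions *)

Section borel_measurable_theory.
Context d (T : measurableType d) (R : realType).
Implicit Types V : normedModType R[i].

Lemma borel_measurable_rball V (f : T -> V) : borel_measurable f ->
  forall c (r : R), measurable [set w | rnorm (f w - c) < r].
Proof.
move=> mf c r.
have := mf measurableT [set y | rnorm (y - c) < r]; rewrite setTI; apply.
by apply: sub_sigma_algebra; exact: open_rball.
Qed.

Lemma measurable_fun_lt (f : T -> R) :
  (forall r, measurable [set w | f w < r]) -> measurable_fun setT f.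
Proof.
move=> mf; apply: (measurability _ (RGenInftyO.measurableE R)) => //.
move=> _ [_ [r ->] <-]; rewrite setTI.
by rewrite (_ : _ @^-1` _ = [set w | f w < r])//; apply/seteqP; split => w /=; rewrite in_itv.
Qed.

Lemma borel_measurable_rnormB V (f : T -> V) c : borel_measurable f ->
  measurable_fun setT (fun w => rnorm (f w - c)).
Proof. by move=> mf; apply: measurable_fun_lt => r; exact: borel_measurable_rball. Qed.

Lemma borel_measurable_rnorm V (f : T -> V) : borel_measurable f ->
  measurable_fun setT (fun w => rnorm (f w)).
Proof.
move=> /(@borel_measurable_rnormB _ _ 0); congr measurable_fun.
by apply/funext => w; rewrite subr0.
Qed.

Lemma measurable_lt (f : T -> R) (r : R) : measurable_fun setT f ->
  measurable [set w | f w < r].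
Proof.
move=> mf; have := mf measurableT `]-oo, r[%classic (measurable_itv _).
by rewrite setTI; congr measurable; apply/seteqP; split => w /=; rewrite in_itv.
Qed.

(** [f] is the pointwise infimum of the [g n], and [f w < r] exactly when some [g n w < r], so no
    infimum has to be formed. *)
Lemma measurable_fun_approx_inf (f : T -> R) (g : nat -> T -> R) :
  (forall n, measurable_fun setT (g n)) -> (forall n w, f w <= g n w) ->
  (forall w (e : R), 0 < e -> exists n, g n w < f w + e) ->
  measurable_fun setT f.
Proof.
move=> mg fg gf; apply: measurable_fun_lt => r.
rewrite (_ : [set _ | _] = \bigcup_n [set w | g n w < r]).
  by apply: bigcup_measurable => n _; exact: measurable_lt.
apply/seteqP; split => [w /= fr|w [n _ /=]]; last exact: le_lt_trans.
have [|n] := gf w (r - f w); first by rewrite subr_gt0.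
by rewrite addrC subrK; exists n.
Qed.

Lemma measurable_fun_of_sqr (f : T -> R) : (forall w, 0 <= f w) ->
  measurable_fun setT (fun w => f w ^+ 2) -> measurable_fun setT f.
Proof.
move=> f0 mf; apply: measurable_fun_lt => r.
have [r0|r0] := ltP 0 r.
  rewrite (_ : [set _ | _] = [set w | f w ^+ 2 < r ^+ 2]); first exact: measurable_lt.
  by apply/seteqP; split=> w /=; rewrite ltr_pXn2r ?nnegrE// ltW.
rewrite (_ : [set _ | _] = set0)//; apply/seteqP; split=> w //=.
by rewrite ltNge (le_trans r0).
Qed.

Lemma measurable_fun_posV (f : T -> R) : (forall w, 0 < f w) ->
  measurable_fun setT f -> measurable_fun setT (fun w => (f w)^-1).
Proof.
move=> f0 mf; apply: measurable_fun_lt => r; have [r0|r0] := ltP 0 r.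
  rewrite (_ : [set _ | _] = [set w | - f w < - r^-1]).
    by apply: measurable_lt; exact: measurableT_comp.
  by apply/seteqP; split=> w /=; rewrite ltrN2 invf_plt ?posrE.
rewrite (_ : [set _ | _] = set0)//; apply/seteqP; split=> w //=.
by rewrite ltNge (le_trans r0)// invr_ge0 ltW.
Qed.

Lemma borel_measurable_cst V (c : V) : borel_measurable (fun _ : T => c).
Proof. exact: measurable_cst. Qed.

Section dense.
Context {V : normedModType R[i]} (a : nat -> V).
Hypothesis da : dense_seq a.

(* Every open set is a union of balls with centres [a n] and radii [1 / k.+1]. *)
Lemma borel_measurable_balls (f : T -> V) :
  (forall n (r : R), measurable [set w | rnorm (f w - a n) < r]) ->
  borel_measurable f.
Proof.
move=> mf; rewrite /borel_measurable.
apply: (@measurability _ _ T (g_sigma_algebraType (@open V)) _ _ (@open V)) => //.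
move=> _ [U oU <-]; rewrite setTI.
pose P n k := [set y | rnorm (y - a n) < (k.+1%:R^-1 : R)] `<=` U.
rewrite (_ : _ @^-1` _ =
    \bigcup_n \bigcup_(k in P n) [set w | rnorm (f w - a n) < k.+1%:R^-1]).
  by apply: bigcup_measurable => n _; apply: bigcup_measurable => k _; exact: mf.
apply/seteqP; split => [w /= Ufw|w [n _ [k PU /=]]]; last exact: PU.
have [e e0 eU] := open_rnorm oU Ufw.
(* A ball of radius below [e / 2] that contains [f w] lies in the ball of radius [e] about [f w],
   hence in [U]. *)
pose k := Num.bound (e / 2)^-1.
have ke : (k.+1%:R^-1 : R) < e / 2.
  rewrite invf_plt ?posrE ?divr_gt0//; apply: lt_le_trans (archi_boundP _) _.
    by rewrite invr_ge0 divr_ge0// ltW.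
  by rewrite ler_nat.
have k0 : 0 < k.+1%:R^-1 :> R by rewrite invr_gt0.
have [n fn] := da (f w) k0; exists n => //; exists k => //.
move=> y /= yn; apply: eU; have := rnorm_dist y (a n) (f w).
by rewrite (rnormC (a n)); move: yn fn ke; move: (k.+1%:R^-1) => t; lra.
Qed.

Lemma borel_measurable_of_rnorm (f : T -> V) :
  (forall c, measurable_fun setT (fun w => rnorm (f w - c))) -> borel_measurable f.
Proof. by move=> mf; apply: borel_measurable_balls => n r; exact: measurable_lt. Qed.

Lemma borel_measurable_inf (f : T -> V) (g : V -> nat -> T -> R) :
  (forall c n, measurable_fun setT (g c n)) ->
  (forall c n w, rnorm (f w - c) <= g c n w) ->
  (forall c w (e : R), 0 < e -> exists n, g c n w < rnorm (f w - c) + e) ->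
  borel_measurable f.
Proof.
move=> mg fg gf; apply: borel_measurable_of_rnorm => c.
exact: (measurable_fun_approx_inf (mg c) (fg c) (gf c)).
Qed.

(** [|f + g - c|] is the infimum over [n] of [|f - a n| + |g - (c - a n)|], approached as [a n]
    tends to [f w]. This avoids the product sigma-algebra. *)
Lemma borel_measurableD (f g : T -> V) :
  borel_measurable f -> borel_measurable g -> borel_measurable (fun w => f w + g w).
Proof.
move=> mf mg.
apply: (@borel_measurable_inf _ (fun c n w => rnorm (f w - a n) + rnorm (g w - (c - a n)))).
- by move=> c n; apply: measurable_funD; exact: borel_measurable_rnormB.
- move=> c n w; apply: le_trans (rnormD _ _); rewrite addrACA -opprD.
  by rewrite (addrC (a n)) subrK.
- move=> c w e e0; have [n fn] := da (f w) (divr_gt0 e0 (ltr0n _ 2)); exists n.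
  have := rnormD (f w + g w - c) (a n - f w).
  rewrite (_ : f w + g w - c + _ = g w - (c - a n)); last first.
    by rewrite opprB addrC -(addrA (f w)) addrA subrK addrCA.
  by rewrite (rnormC (a n)); lra.
Qed.

(** To be read as [f w = Phi w (g w)] with every [Phi w] Lipschitz of constant [M], where [F n w] is
    the value of [Phi w] at the point [b n] of a dense sequence. It yields measurability of range
    operators applied to measurable fields. *)
Lemma borel_measurable_lip V' (b : nat -> V') (F : nat -> T -> V) (g : T -> V')
    (f : T -> V) (M : R) : dense_seq b ->
  (forall n, borel_measurable (F n)) -> borel_measurable g ->
  (forall n w, rnorm (f w - F n w) <= M * rnorm (g w - b n)) ->
  borel_measurable f.
Proof.
move=> db mF mg fF.
apply: (@borel_measurable_inf _
  (fun c n w => rnorm (F n w - c) + `|M| * rnorm (g w - b n))).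
- move=> c n; apply: measurable_funD; first exact: borel_measurable_rnormB.
  by apply: measurable_funM => //; exact: borel_measurable_rnormB.
- move=> c n w; apply: le_trans (rnorm_dist _ (F n w) _) _; rewrite addrC lerD2l.
  by apply: le_trans (fF n w) _; rewrite ler_wpM2r ?rnorm_ge0 ?ler_norm.
(* No sign of [M] is assumed, and it may be 0: hence [|M| + 1]. The error at most [e / 4] enters
   twice. *)
- move=> c w e e0; have M1 : 0 < 4 * (`|M| + 1) by rewrite mulr_gt0// ltr_wpDl.
  have [n fn] := db (g w) _ (divr_gt0 e0 M1); exists n.
  have := rnorm_dist (F n w) (f w) c; rewrite (rnormC _ (f w)).
  have /= := fF n w.
  have : M * rnorm (g w - b n) <= `|M| * rnorm (g w - b n).
    by rewrite ler_wpM2r ?rnorm_ge0 ?ler_norm.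
  have : `|M| * rnorm (g w - b n) <= e / 4.
    apply: (@le_trans _ _ ((`|M| + 1) * (e / (4 * (`|M| + 1))))).
      by apply: ler_pM; rewrite ?rnorm_ge0 ?lerDl// ltW.
    by rewrite le_eqVlt; apply/orP; left; apply/eqP; field; rewrite gt_eqF// ltr_wpDl.
  lra.
Qed.

(** For a fixed vector the product is Lipschitz in the scalar. In the vector variable the constant
    [|g w|] is not uniform in [w], so there [|g f - c|] is written directly as the infimum of
    [|g| |f - a n| + |g a n - c|]. *)
Lemma borel_measurableZ (g : T -> R[i]^o) (f : T -> V) :
  borel_measurable g -> borel_measurable f -> borel_measurable (fun w => g w *: f w).
Proof.
move=> mg mf; have [q dq] := @complex_dense_seq R.
have mgv (v : V) : borel_measurable (fun w => g w *: v).
  apply: (@borel_measurable_lip R[i]^o q (fun n _ => q n *: v) g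
    (fun w => g w *: v) (rnorm v)) => //.
    by move=> n; exact: borel_measurable_cst.
  by move=> n w; rewrite -scalerBl rnormZ mulrC.
apply: (@borel_measurable_inf _
  (fun c n w => rnorm (g w) * rnorm (f w - a n) + rnorm (g w *: a n - c))).
- move=> c n; apply: measurable_funD; last exact: borel_measurable_rnormB.
  by apply: measurable_funM; [exact: borel_measurable_rnorm|exact: borel_measurable_rnormB].
- move=> c n w; apply: le_trans (rnorm_dist _ (g w *: a n) _) _.
  by rewrite lerD2r -scalerBr rnormZ.
- move=> c w e e0; set t := rnorm (g w).
  have t0 : 0 <= t by exact: rnorm_ge0.
  have t1 : 0 < 4 * (t + 1) by rewrite mulr_gt0// ltr_wpDl.
  have [n fn] := da (f w) (divr_gt0 e0 t1); exists n.
  have := rnorm_dist (g w *: a n) (g w *: f w) c.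
  rewrite (rnormC _ (g w *: f w)) -scalerBr rnormZ -/t.
  have : t * rnorm (f w - a n) <= e / 4.
    apply: (@le_trans _ _ ((t + 1) * (e / (4 * (t + 1))))).
      by apply: ler_pM; rewrite ?rnorm_ge0 ?lerDl// ltW.
    by rewrite le_eqVlt; apply/orP; left; apply/eqP; field; rewrite gt_eqF// ltr_wpDl.
  lra.
Qed.

Lemma borel_measurableN (f : T -> V) :
  borel_measurable f -> borel_measurable (fun w => - f w).
Proof.
move=> mf; under eq_fun do rewrite -scaleN1r.
by apply: borel_measurableZ mf; exact: borel_measurable_cst.
Qed.

Lemma borel_measurableB (f g : T -> V) :
  borel_measurable f -> borel_measurable g -> borel_measurable (fun w => f w - g w).
Proof. by move=> mf /borel_measurableN; exact: borel_measurableD. Qed.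

End dense.

(** Polarisation: [2 Re z = |z|^2 - |z - 1|^2 + 1], and similarly for the imaginary part with [i] in
    place of 1. *)
Lemma borel_measurable_Re (f : T -> R[i]^o) : borel_measurable f ->
  measurable_fun setT (fun w => complex.Re (f w)).
Proof.
move=> mf; rewrite (_ : (fun w => _) =
    (fun w => 2^-1 * (rnorm (f w) ^+ 2 - rnorm (f w - 1) ^+ 2 + 1))).
  apply: measurable_funM => //; apply: measurable_funD => //.
  by apply: measurable_funB; apply: measurable_funX;
    [exact: borel_measurable_rnorm|exact: borel_measurable_rnormB].
by apply/funext => w; rewrite !sqr_rnorm; case: (f w) => x y /=; lra.
Qed.

Lemma borel_measurable_Im (f : T -> R[i]^o) : borel_measurable f ->
  measurable_fun setT (fun w => complex.Im (f w)).
Proof.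
move=> mf; rewrite (_ : (fun w => _) =
    (fun w => 2^-1 * (rnorm (f w) ^+ 2 - rnorm (f w - Complex 0 1) ^+ 2 + 1))).
  apply: measurable_funM => //; apply: measurable_funD => //.
  by apply: measurable_funB; apply: measurable_funX;
    [exact: borel_measurable_rnorm|exact: borel_measurable_rnormB].
by apply/funext => w; rewrite !sqr_rnorm; case: (f w) => x y /=; lra.
Qed.

Lemma borel_measurable_complex (f : T -> R[i]^o) :
  measurable_fun setT (fun w => complex.Re (f w)) ->
  measurable_fun setT (fun w => complex.Im (f w)) -> borel_measurable f.
Proof.
move=> mRe mIm; have [q dq] := @complex_dense_seq R.
apply: (borel_measurable_of_rnorm dq) => c.
apply: measurable_fun_of_sqr => [w|]; first exact: rnorm_ge0.
rewrite (_ : (fun w => _) = (fun w => (complex.Re (f w) - complex.Re c) ^+ 2 +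
    (complex.Im (f w) - complex.Im c) ^+ 2)).
  by apply: measurable_funD; apply: measurable_funX; exact: measurable_funB.
by apply/funext => w; rewrite sqr_rnorm; case: (f w) c => x y [].
Qed.

Section hilbert.
Variables (H : completeNormedModType R[i]) (dot : {dot H for @Num.conj R[i]}).
Hypothesis dotE : induces_norm dot.
Variables (a : nat -> H).
Hypothesis da : dense_seq a.

Lemma measurable_redot (f g : T -> H) : borel_measurable f -> borel_measurable g ->
  measurable_fun setT (fun w => redot dot (f w) (g w)).
Proof.
move=> mf mg; rewrite (_ : (fun w => _) = (fun w =>
    2^-1 * (rnorm (f w + g w) ^+ 2 - rnorm (f w) ^+ 2 - rnorm (g w) ^+ 2))).
  apply: measurable_funM => //; apply: measurable_funB; last first.
    exact/measurable_funX/borel_measurable_rnorm.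
  apply: measurable_funB; apply/measurable_funX/borel_measurable_rnorm => //.
  exact: borel_measurableD da _ _ _ _.
by apply/funext => w; rewrite (sqr_rnormD dotE); lra.
Qed.

Lemma borel_measurable_dot (f g : T -> H) : borel_measurable f -> borel_measurable g ->
  borel_measurable (fun w => dot (f w) (g w) : R[i]^o).
Proof.
move=> mf mg; apply: borel_measurable_complex; first exact: measurable_redot.
under eq_fun do rewrite Im_dot; apply: measurable_redot => //.
by apply: (borel_measurableZ da) mg; exact: borel_measurable_cst.
Qed.

(* Pettis: [- |x|^2] is the infimum of [|b|^2 - 2 Re <x, b>] over a dense set of [b]. *)
Lemma borel_measurable_weak (f : T -> H) :
  (forall b, borel_measurable (fun w => dot (f w) b : R[i]^o)) -> borel_measurable f.
Proof.
move=> mf; apply: (borel_measurable_of_rnorm da) => c.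
apply: measurable_fun_of_sqr => [w|]; first exact: rnorm_ge0.
under eq_fun do rewrite -[_ ^+ 2]opprK.
apply: measurableT_comp => //.
apply: (@measurable_fun_approx_inf _
  (fun n w => rnorm (a n) ^+ 2 - 2 * (redot dot (f w) (a n) - redot dot c (a n)))).
- move=> n; apply: measurable_funB => //; apply: measurable_funM => //.
  by apply: measurable_funB => //; exact: borel_measurable_Re (mf _).
- move=> n w; have := sqr_ge0 (rnorm (f w - c - a n)).
  by rewrite (sqr_rnormB dotE (f w - c)) redotDl redotNl; lra.
- move=> w e e0; have e1 : 0 < Num.sqrt e by rewrite sqrtr_gt0.
  have [n] := da (f w - c) e1; exists n.
  have : rnorm (f w - c - a n) ^+ 2 < e.
    by rewrite -[ltRHS](sqr_sqrtr (ltW e0)) ltr_pXn2r ?nnegrE ?rnorm_ge0 ?ltW.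
  by rewrite (sqr_rnormB dotE (f w - c)) redotDl redotNl; lra.
Qed.

End hilbert.

Lemma borel_measurable_if V (N : set T) (f : T -> V) : measurable N ->
  borel_measurable f -> borel_measurable (fun w => if w \in N then 0 else f w).
Proof.
move=> mN mf; apply: measurable_fun_ifT; [|exact: measurable_cst|exact: mf].
apply: (measurable_fun_bool true); rewrite setTI.
rewrite (_ : _ @^-1` _ = N)//; apply/seteqP; split=> w /=; first by move/set_mem.
exact: mem_set.
Qed.

End borel_measurable_theory.

(** * Integral representation of functionals on bounded functions *)

Section functional_density.
Context d (T : measurableType d) (R : realType).

(** Bounded everywhere, so that the class does not depend on a measure; [Linfty_ReIm] provides such
    representatives. *)
Definition bounded_measurable (f : T -> R) :=
  measurable_fun setT f /\ exists K, forall w, `|f w| <= K.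

Lemma bounded_measurableDZ k f g : bounded_measurable f -> bounded_measurable g ->
  bounded_measurable (fun w => k * f w + g w).
Proof.
move=> [mf [K fK]] [mg [L gL]]; split.
  by apply: measurable_funD => //; exact: measurable_funM.
exists (`|k| * K + L) => w; apply: le_trans (ler_normD _ _) _.
by rewrite lerD// normrM ler_wpM2l.
Qed.

Lemma bounded_measurable_cst k : bounded_measurable (fun=> k).
Proof. by split; [exact: measurable_cst|exists `|k|]. Qed.

Lemma bounded_measurable_indic (A : set T) : measurable A ->
  bounded_measurable (\1_A : T -> R).
Proof.
move=> mA; split; first exact: measurable_indic.
by exists 1 => w; rewrite indicE; case: (_ \in _); rewrite ?normr1 ?normr0.
Qed.

Lemma integrable_bounded_mul (mu : {measure set T -> \bar R}) f g :
  bounded_measurable f -> mu.-integrable setT (EFin \o g) ->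
  mu.-integrable setT (EFin \o (fun w => f w * g w)).
Proof.
move=> [mf [K fK]] ig; have /measurable_EFinP mg := measurable_int _ ig.
apply: (@le_integrable _ _ _ mu setT measurableT _ (fun w => `|K|%:E * (g w)%:E)%E).
- by apply/measurable_EFinP; exact: measurable_funM.
- move=> w _ /=; rewrite lee_fin !normrM normr_id ler_wpM2r//.
  by apply: le_trans (fK w) _; exact: ler_norm.
- exact: integrableZl.
Qed.

Lemma cvg_Rintegral (mu : {measure set T -> \bar R}) (f_ : nat -> T -> R) f g :
  (forall n, measurable_fun setT (f_ n)) -> (forall w, f_ n w @[n --> \oo] --> f w) ->
  mu.-integrable setT (EFin \o g) -> (forall n w, `|f_ n w| <= g w) ->
  \int[mu]_w f_ n w @[n --> \oo] --> \int[mu]_w f w.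
Proof.
move=> mf_ f_f ig f_g.
have mf : measurable_fun setT f.
  by apply: (measurable_fun_cvg (h := f_)) => // w _; exact: f_f.
have [||||| if_ _ cf] := @dominated_convergence _ _ _ mu setT measurableT
  (fun n w => (f_ n w)%:E) (EFin \o f) (EFin \o g).
- by move=> n; exact/measurable_EFinP.
- exact/measurable_EFinP.
- by apply: nearW => w _; apply: cvg_EFin; [exact: nearW|exact: f_f].
- exact: ig.
- by apply: nearW => w n _; rewrite /= lee_fin.
have := fine_cvg (_ : _ --> (\int[mu]_w f w)%:E); apply.
rewrite /Rintegral fineK; first exact: cf.
exact: integrable_fin_num.
Qed.

Variables (mu : {sigma_finite_measure set T -> \bar R}).
Variables (rho : (T -> R) -> R) (v : T -> R) (c C : R).
Hypothesis iv : mu.-integrable setT (EFin \o v).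
Hypothesis v0 : forall w, 0 <= v w.
Hypothesis C0 : 0 <= C.
Hypothesis rhoDZ : forall k f g, bounded_measurable f -> bounded_measurable g ->
  rho (fun w => k * f w + g w) = k * rho f + rho g.
(* A Cauchy-Schwarz bound |rho f|^2 <= 4 c C \int f^2 v, in AM-GM form to avoid Hoelder. *)
Hypothesis rho_le : forall f (t : R), bounded_measurable f -> 0 < t ->
  `|rho f| <= t * c + t^-1 * (C * \int[mu]_w (f w ^+ 2 * v w)).

Let rho0 : rho (fun=> 0) = 0.
Proof.
have := rhoDZ 1 (bounded_measurable_cst 0) (bounded_measurable_cst 0).
under eq_fun do rewrite mulr0 addr0.
by rewrite mul1r => /eqP; rewrite -subr_eq0 opprD addrA subrr add0r oppr_eq0 => /eqP.
Qed.

Let rhoB f g : bounded_measurable f -> bounded_measurable g ->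
  rho (fun w => f w - g w) = rho f - rho g.
Proof.
move=> bf bg; have := rhoDZ (-1) bg bf; rewrite mulN1r [X in _ = X]addrC => <-.
by congr rho; apply/funext => w; rewrite mulN1r addrC.
Qed.

(** Continuity under bounded pointwise convergence: by dominated convergence the integrals of
    [(f_ n - f)^2 v] tend to 0, with majorant [(K + K)^2 v]. In [rho_le] one fixes a small [t]
    first, then takes [n] large. *)
Let rho_cvg (f_ : nat -> T -> R) f (K : R) :
  (forall n, measurable_fun setT (f_ n)) -> (forall n w, `|f_ n w| <= K) ->
  (forall w, f_ n w @[n --> \oo] --> f w) ->
  rho (f_ n) @[n --> \oo] --> rho f.
Proof.
move=> mf_ f_K f_f.
have mf : measurable_fun setT f.
  by apply: (measurable_fun_cvg (h := f_)) => // w _; exact: f_f.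
have fK w : `|f w| <= K.
  have fw : `|f_ n w| @[n --> \oo] --> `|f w| by apply: cvg_norm; exact: f_f.
  rewrite -(cvg_lim _ fw)//; apply: limr_le; first exact: cvgP fw.
  by apply: nearW => n; exact: f_K.
have bf : bounded_measurable f by split=> //; exists K.
have bf_ n : bounded_measurable (f_ n) by split=> //; exists K.
have bd n : bounded_measurable (fun w => f_ n w - f w).
  split; first exact: measurable_funB.
  by exists (K + K) => w; apply: le_trans (ler_normB _ _) _; rewrite lerD.
have I0 : \int[mu]_w ((f_ n w - f w) ^+ 2 * v w) @[n --> \oo] --> (0 : R).
  have -> : (0 : R) = \int[mu]_w 0 by rewrite Rintegral_cst// mul0r.
  apply: (@cvg_Rintegral mu _ _ (fun w => (K + K) ^+ 2 * v w)).
  - move=> n; apply: measurable_funM; last first.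
      exact/measurable_EFinP/(measurable_int _ iv).
    by apply: measurable_funX; exact: measurable_funB.
  - move=> w.
    have fw : f_ n w - f w @[n --> \oo] --> (0 : R).
      by rewrite -(subrr (f w)); apply: cvgB; [exact: f_f|exact: cvg_cst].
    have := cvgM (cvgM fw fw) (cvg_cst (v w)); rewrite !mul0r. exact.
  - exact: (@integrableZl _ _ _ mu setT measurableT ((K + K) ^+ 2) _ iv).
  - move=> n w; rewrite normrM (ger0_norm (v0 w)) ler_wpM2r//.
    have K0 : 0 <= K := le_trans (normr_ge0 _) (fK w).
    rewrite normrX ler_pXn2r ?nnegrE ?addr_ge0//.
    by apply: le_trans (ler_normB _ _) _; rewrite lerD.
apply/cvgrPdist_lt => e e0.
(* This [t] makes [t * c] at most [e / 4] whatever the sign of [c]; the later threshold uses [C + 1]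
   because [C] may vanish. *)
have t0 : 0 < e / (4 * (`|c| + 1)) by rewrite divr_gt0// mulr_gt0// ltr_wpDl.
set t := e / _ in t0.
have tc : t * c <= e / 4.
  apply: (@le_trans _ _ (t * (`|c| + 1))).
    by rewrite ler_wpM2l ?(ltW t0)// (le_trans (ler_norm c))// lerDl.
  by rewrite le_eqVlt; apply/orP; left; apply/eqP; rewrite /t; field; rewrite gt_eqF// ltr_wpDl.
have d0 : 0 < e * t / (4 * (C + 1)) by rewrite divr_gt0 ?mulr_gt0// ltr_wpDl.
have /cvgrPdist_lt/(_ _ d0) := I0.
apply: filterS => n; rewrite sub0r normrN => In.
rewrite distrC -rhoB//; apply: le_lt_trans (rho_le (bd n) t0) _.
have {}In : \int[mu]_w ((f_ n w - f w) ^+ 2 * v w) < e * t / (4 * (C + 1)).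
  exact: le_lt_trans (ler_norm _) In.
have : t^-1 * (C * \int[mu]_w ((f_ n w - f w) ^+ 2 * v w)) <= e / 4.
  apply: (@le_trans _ _ (t^-1 * ((C + 1) * (e * t / (4 * (C + 1)))))).
    rewrite ler_wpM2l ?invr_ge0 ?(ltW t0)//; apply: ler_pM => //; last 2 first.
    - by rewrite lerDl.
    - exact: ltW.
    by apply: Rintegral_ge0 => w _; rewrite mulr_ge0// sqr_ge0.
  rewrite le_eqVlt; apply/orP; left; apply/eqP; field.
  by rewrite !gt_eqF// ltr_wpDl.
by lra.
Qed.

Let nu (A : set T) : \bar R := (rho \1_A)%:E.

Let nu0 : nu set0 = 0%E.
Proof.
rewrite /nu (_ : \1_set0 = fun=> 0) ?rho0//.
by apply/funext => w; rewrite indicE in_set0.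
Qed.

Let nu_fin A : measurable A -> nu A \is a fin_num. Proof. by []. Qed.

Let nuU A B : measurable A -> measurable B -> A `&` B = set0 ->
  nu (A `|` B) = (nu A + nu B)%E.
Proof.
move=> mA mB AB; rewrite /nu -EFinD -[rho \1_A]mul1r -rhoDZ; last 2 first.
- exact: bounded_measurable_indic.
- exact: bounded_measurable_indic.
congr (rho _)%:E; apply/funext => w; rewrite mul1r !indicE in_setU.
have : ~~ ((w \in A) && (w \in B)).
  apply/negP => /andP[/set_mem Aw /set_mem Bw].
  by have : (A `&` B) w by []; rewrite AB.
by case: (w \in A); case: (w \in B) => //=; rewrite ?addr0 ?add0r.
Qed.

(** At each point the indicators of the partial unions are eventually constant, and they are bounded
    by 1, so [rho_cvg] applies. *)
Let nu_sigma_additive : semi_sigma_additive nu.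
Proof.
move=> F mF tF mUF.
have nuF n : (\sum_(0 <= i < n) nu (F i))%E = nu (\big[setU/set0]_(i < n) F i).
  elim: n => [|n IH]; first by rewrite big_nil big_ord0 nu0.
  rewrite big_nat_recr//= IH big_ord_recr/= nuU//.
    exact: bigsetU_measurable.
  rewrite big_distrl/= big1// => i _; move/trivIsetP: tF; apply => //.
  by rewrite neq_ltn ltn_ord.
under eq_fun do rewrite nuF; apply: cvg_EFin; first exact: nearW.
apply: (rho_cvg (K := 1)).
- by move=> n; apply: measurable_indic; exact: bigsetU_measurable.
- by move=> n w; rewrite indicE; case: (_ \in _); rewrite ?normr1 ?normr0.
move=> w; have [[k _ Fkw]|nF] := pselect ((\bigcup_k F k) w).
  apply: cvg_near_cst; exists k.+1 => // n /= kn.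
  by rewrite !indicE !mem_set//; [exists k|rewrite -bigcup_mkord; exists k].
apply: cvg_near_cst; apply: nearW => n.
by rewrite !indicE !memNset// -bigcup_mkord => -[k _ Fkw]; apply: nF; exists k.
Qed.

HB.instance Definition _ := isCharge.Build _ _ _ nu nu0 nu_fin nu_sigma_additive.

(** On a null set the integral in [rho_le] vanishes for every [t], leaving [|rho \1_A| <= t * c]
    with [t] arbitrarily small. *)
Let nu_dominated : nu `<< mu.
Proof.
apply/null_content_dominatesP => A mA muA.
have I0 : \int[mu]_w ((\1_A w : R) ^+ 2 * v w) = 0.
  transitivity (\int[mu]_(w in A) v w).
    rewrite [RHS]Rintegral_mkcond; apply: eq_Rintegral => w _.
    by rewrite patchE indicE; case: (_ \in _); rewrite ?expr1n ?mul1r// expr0n mul0r.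
  by rewrite /Rintegral null_set_integral//; apply: measurable_funTS; exact: measurable_int iv.
have rho_small t : 0 < t -> `|rho \1_A| <= t * c.
  move=> t0; have := rho_le (bounded_measurable_indic mA) t0.
  by rewrite I0 !mulr0 addr0.
rewrite /nu; congr EFin; apply/eqP; rewrite -normr_le0 leNgt; apply/negP => r0.
have := rho_small _ (divr_gt0 r0 (_ : 0 < 2 * (`|c| + 1))).
rewrite mulr_gt0// ?ltr_wpDl// => /(_ isT); apply/negP; rewrite -ltNge.
apply: (@le_lt_trans _ _ (`|rho \1_A| / 2)); last by lra.
rewrite -mulrA ler_wpM2l// mulrC ler_pdivrMr ?mulr_gt0 ?ltr_wpDl//.
by have := ler_norm c; lra.
Qed.

Let r w := fine (Radon_Nikodym nu mu w).

Let ir : mu.-integrable setT (EFin \o r).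
Proof.
apply: eq_integrable (Radon_Nikodym_integrable nu_dominated) => //.
by move=> w _ /=; rewrite /r fineK//; exact: Radon_Nikodym_fin_num.
Qed.

Let rho_indic A : measurable A -> rho \1_A = \int[mu]_w ((\1_A w : R) * r w).
Proof.
move=> mA; transitivity (\int[mu]_(w in A) r w).
  apply: EFin_inj; apply: (etrans (Radon_Nikodym_integral nu_dominated mA)).
  rewrite /Rintegral fineK.
    by apply: eq_integral => w _; rewrite /r fineK//; exact: Radon_Nikodym_fin_num.
  by apply: integrable_fin_num => //; exact: integrableS ir.
rewrite Rintegral_mkcond; apply: eq_Rintegral => w _.
by rewrite patchE indicE; case: (_ \in _); rewrite ?mul1r ?mul0r.
Qed.

Let rho_intDZ k f g : bounded_measurable f -> bounded_measurable g ->
  rho f = \int[mu]_w (f w * r w) -> rho g = \int[mu]_w (g w * r w) ->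
  rho (fun w => k * f w + g w) = \int[mu]_w ((k * f w + g w) * r w).
Proof.
move=> bf bg rf rg; rewrite rhoDZ// rf rg -RintegralZl//; last exact: integrable_bounded_mul.
rewrite -RintegralD//; last 2 first.
- exact: (@integrableZl _ _ _ mu setT measurableT k _ (integrable_bounded_mul bf ir)).
- exact: integrable_bounded_mul.
by apply: eq_Rintegral => w _; rewrite mulrDl mulrA.
Qed.

Let rho_simple (h : {nnsfun T >-> R}) : rho h = \int[mu]_w (h w * r w).
Proof.
have [s ->] : exists s : seq R,
    (h : T -> R) = (fun w => \sum_(y <- s) y * \1_(h @^-1` [set y]) w).
  exists (finmap.enum_fset (fset_set (range h))).
  by apply/funext => w; rewrite fimfunE fsbig_finite.
(* Induction over an arbitrary list of values, since a partial sum is no longer [h]; boundedness is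
   carried along because linearity of [rho] requires it. *)
suff [] : let g := fun w => \sum_(y <- s) y * \1_(h @^-1` [set y]) w in
  bounded_measurable g /\ rho g = \int[mu]_w (g w * r w) by [].
elim: s => [|y s [bg rg]] /=.
  under eq_fun do rewrite big_nil; split; first exact: bounded_measurable_cst.
  rewrite rho0; under eq_Rintegral do rewrite big_nil mul0r.
  by rewrite Rintegral_cst// mul0r.
under eq_fun do rewrite big_cons; under eq_Rintegral do rewrite big_cons.
have bi : bounded_measurable (\1_(h @^-1` [set y]) : T -> R).
  exact: bounded_measurable_indic.
by split; [exact: bounded_measurableDZ|apply: rho_intDZ => //; exact: rho_indic].
Qed.

(** The density is the Radon-Nikodym derivative of [nu]. The formula passes from indicators to
    simple functions by linearity, then to nonnegative bounded functions by increasing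
    approximation: [rho_cvg] on one side, dominated convergence on the other. *)
Lemma functional_density : exists2 r : T -> R, mu.-integrable setT (EFin \o r) &
  forall f, bounded_measurable f -> rho f = \int[mu]_w (f w * r w).
Proof.
exists r => //.
have rho_ge0 f : bounded_measurable f -> (forall w, 0 <= f w) ->
    rho f = \int[mu]_w (f w * r w).
  move=> bf f0; have [mf [K fK]] := bf.
  have mf' : measurable_fun setT (EFin \o f) by exact/measurable_EFinP.
  pose h n : {nnsfun T >-> R} := nnsfun_approx measurableT mf' n.
  have h_f w : h n w @[n --> \oo] --> f w.
    have := @cvg_nnsfun_approx _ _ _ _ measurableT _ mf' (fun w _ => f0 w) w I.
    by move=> /fine_cvg.
  have h_le n w : h n w <= f w.
    rewrite -(cvg_lim _ (h_f w))//; apply: nondecreasing_cvgn_le; last exact: cvgP (h_f w).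
    move=> m k mk.
    by have /lefP := @nd_nnsfun_approx _ _ _ _ measurableT _ mf' _ _ mk; exact.
  have h_norm n w : `|h n w| <= `|f w|.
    by rewrite !ger0_norm//.
  have h_rho : rho (h n) @[n --> \oo] --> rho f.
    apply: (rho_cvg (K := K)) => [//|n w|w]; last exact: h_f.
    exact: le_trans (h_norm n w) (fK w).
  have h_int : \int[mu]_w (h n w * r w) @[n --> \oo] --> \int[mu]_w (f w * r w).
    have mr : measurable_fun setT r by exact/measurable_EFinP/(measurable_int _ ir).
    apply: (@cvg_Rintegral mu _ _ (fun w => `|f w * r w|)).
    - by move=> n; apply: measurable_funM.
    - by move=> w; apply: cvgM; [exact: h_f|exact: cvg_cst].
    - exact/integrable_norm/integrable_bounded_mul.
    - by move=> n w; rewrite !normrM ler_wpM2r.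
  move: h_rho; under eq_cvg do rewrite rho_simple; move=> h_rho.
  exact: cvg_unique h_rho h_int.
move=> f bf; have [mf [K fK]] := bf.
(* Shifting by the constant [|K|] reduces to nonnegative functions without splitting [f] into its
   positive and negative parts. *)
have f1 : f = (fun w => -1 * `|K| + (f w + `|K|)).
  by apply/funext => w; rewrite mulN1r addrC addrK.
rewrite f1; apply: (@rho_intDZ (-1) (fun=> `|K|)).
- exact: bounded_measurable_cst.
- have := bounded_measurableDZ 1 bf (bounded_measurable_cst `|K|).
  by under eq_fun do rewrite mul1r.
- by apply: rho_ge0 => // ; exact: bounded_measurable_cst.
- apply: rho_ge0.
    have := bounded_measurableDZ 1 bf (bounded_measurable_cst `|K|).
    by under eq_fun do rewrite mul1r.
  move=> w; rewrite -[f w]opprK addrC subr_ge0 (le_trans (ler_norm _))// normrN.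
  exact: le_trans (fK w) (ler_norm _).
Qed.

End functional_density.

(** * Square integrable functions *)

Section L2_theory.
Context d (T : measurableType d) (R : realType) (mu : {measure set T -> \bar R}).
Implicit Types V : normedModType R[i].

(** The squared norm as a real number; it has this meaning only on [L2], because [fine] sends an
    infinite integral to 0. *)
Definition sqnorm V (f : T -> V) : R := \int[mu]_w (rnorm (f w) ^+ 2).

Lemma measurable_sqr_rnorm V (f : T -> V) : borel_measurable f ->
  measurable_fun setT (fun w => rnorm (f w) ^+ 2).
Proof. by move=> mf; exact/measurable_funX/borel_measurable_rnorm. Qed.

Lemma L2P V (f : T -> V) : L2 mu f <->
  borel_measurable f /\ mu.-integrable setT (EFin \o (fun w => rnorm (f w) ^+ 2)).
Proof.
split=> -[mf fi]; split => //.
  apply/integrableP; split; first exact/measurable_EFinP/measurable_sqr_rnorm.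
  by under eq_integral do rewrite /= ger0_norm ?sqr_ge0//.
have /integrableP[_] := fi.
by under eq_integral do rewrite /= ger0_norm ?sqr_ge0//.
Qed.

Lemma sqnorm_ge0 V (f : T -> V) : 0 <= sqnorm f.
Proof. by apply: Rintegral_ge0 => w _; exact: sqr_ge0. Qed.

Lemma L2normE V (f : T -> V) : L2 mu f -> L2norm mu f = (Num.sqrt (sqnorm f))%:E.
Proof.
move=> /L2P[mf fi]; rewrite /L2norm unlock.
rewrite poweR12_sqrt; last by apply: integral_ge0 => w _; exact: poweR_ge0.
rewrite (_ : (\int[mu]_w _)%E = (sqnorm f)%:E)// /sqnorm /Rintegral fineK.
  apply: eq_integral => w _; rewrite /= ger0_norm ?rnorm_ge0//.
  by rewrite -powR_mulrn ?rnorm_ge0.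
exact: integrable_fin_num.
Qed.

Lemma L2norm_le V V' (f : T -> V) (g : T -> V') (M : R) : 0 <= M ->
  L2 mu f -> L2 mu g ->
  (L2norm mu f <= M%:E * L2norm mu g)%E <-> sqnorm f <= M ^+ 2 * sqnorm g.
Proof.
move=> M0 fL gL; rewrite !L2normE// -EFinM lee_fin.
rewrite -[X in X * _](ger0_norm M0) -sqrtr_sqr -sqrtrM ?sqr_ge0//.
by rewrite ler_sqrt// mulr_ge0 ?sqr_ge0 ?sqnorm_ge0.
Qed.

Lemma L2norm_le1 V (f : T -> V) : L2 mu f ->
  (L2norm mu f <= 1)%E <-> sqnorm f <= 1.
Proof. by move=> fL; rewrite L2normE// lee_fin -{1}sqrtr1 ler_sqrt. Qed.

Lemma L2_dominated V V' (f : T -> V) (g : T -> V') (M : R) : 0 <= M ->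
  borel_measurable f -> L2 mu g ->
  {ae mu, forall w, rnorm (f w) <= M * rnorm (g w)} ->
  L2 mu f /\ sqnorm f <= M ^+ 2 * sqnorm g.
Proof.
move=> M0 mf /L2P[mg gi] fg.
have gi' : mu.-integrable setT (EFin \o (fun w => M ^+ 2 * rnorm (g w) ^+ 2)).
  exact: (@integrableZl _ _ _ mu setT measurableT (M ^+ 2) _ gi).
have le_int : (\int[mu]_w (rnorm (f w) ^+ 2)%:E <=
               \int[mu]_w (M ^+ 2 * rnorm (g w) ^+ 2)%:E)%E.
  apply: ae_ge0_le_integral => //.
  - by move=> w _; rewrite lee_fin sqr_ge0.
  - exact/measurable_EFinP/measurable_sqr_rnorm.
  - by move=> w _; rewrite lee_fin mulr_ge0 ?sqr_ge0.
  - exact: measurable_int gi'.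
  - apply: filterS fg => w fgw _; rewrite lee_fin -exprMn.
    by rewrite ler_pXn2r ?nnegrE ?mulr_ge0 ?rnorm_ge0.
have fL : L2 mu f.
  split=> //; apply: le_lt_trans le_int _.
  by have := integrable_fin_num measurableT gi'; rewrite fin_numElt => /andP[].
split=> //; have /L2P[_ fi] := fL.
rewrite /sqnorm -RintegralZl// /Rintegral fine_le//.
- exact: integrable_fin_num.
- exact: integrable_fin_num.
Qed.

Lemma sqnorm_eq0_ae V (f : T -> V) : L2 mu f -> sqnorm f = 0 ->
  {ae mu, forall w, f w = 0}.
Proof.
move=> /L2P[mf fi] f0.
have /ae_eq_integral_abs : (\int[mu]_w `|(rnorm (f w) ^+ 2)%:E| = 0)%E.
  under eq_integral do rewrite /= ger0_norm ?sqr_ge0//.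
  rewrite -[LHS]fineK; first exact: (congr1 EFin f0).
  exact: integrable_fin_num.
move=> /(_ measurableT) h.
have /h : measurable_fun setT (fun w => (rnorm (f w) ^+ 2)%:E).
  exact/measurable_EFinP/measurable_sqr_rnorm.
apply: filterS => w /(_ I) [] /eqP; rewrite sqrf_eq0 => /eqP.
exact: rnorm_eq0.
Qed.

Lemma ae_sqnorm0 V (f : T -> V) : L2 mu f -> {ae mu, forall w, f w = 0} ->
  sqnorm f = 0.
Proof.
move=> [mf _] f0; rewrite /sqnorm /Rintegral.
rewrite (ae_eq_integral (cst 0%E))//; first by rewrite integral0.
  exact/measurable_EFinP/measurable_sqr_rnorm.
by apply: filterS f0 => w -> _; rewrite rnorm0 expr0n.
Qed.

Lemma L2B V (a : nat -> V) (f g : T -> V) : dense_seq a -> L2 mu f -> L2 mu g ->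
  L2 mu (fun w => f w - g w).
Proof.
move=> da /L2P[mf fi] /L2P[mg gi]; apply/L2P.
have mfg := borel_measurableB da mf mg; split=> //.
apply: (@le_integrable _ _ _ mu setT measurableT _
  ((fun w => 2%:E * (rnorm (f w) ^+ 2)%:E) \+ (fun w => 2%:E * (rnorm (g w) ^+ 2)%:E))%E).
- exact/measurable_EFinP/measurable_sqr_rnorm.
- move=> w _; rewrite /= lee_fin ger0_norm ?sqr_ge0//.
  apply: le_trans (ler_norm _).
  have := rnormD (f w) (- g w); rewrite rnormN => h.
  have := rnorm_ge0 (f w - g w); have := sqr_ge0 (rnorm (f w) - rnorm (g w)).
  nra.
- by apply: integrableD => //; exact: integrableZl.
Qed.

(** Test on [E = {g < f}]: there [f - g] is positive while its integral is at most 0, so it vanishes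
    a.e. on [E]. *)
Lemma ae_le_of_integral (f g : T -> R) :
  mu.-integrable setT (EFin \o f) -> mu.-integrable setT (EFin \o g) ->
  (forall E, measurable E -> \int[mu]_(w in E) f w <= \int[mu]_(w in E) g w) ->
  {ae mu, forall w, f w <= g w}.
Proof.
move=> fi gi fg.
have mf : measurable_fun setT f by exact/measurable_EFinP/(measurable_int _ fi).
have mg : measurable_fun setT g by exact/measurable_EFinP/(measurable_int _ gi).
pose E := [set w | (g w - f w) < 0].
have mE : measurable E by apply: measurable_lt; exact: measurable_funB.
have fE : mu.-integrable E (EFin \o f) by exact: integrableS fi.
have gE : mu.-integrable E (EFin \o g) by exact: integrableS gi.
have I0 : (\int[mu]_(w in E) `|(f w - g w)%:E| = 0)%E.
  have -> : (\int[mu]_(w in E) `|(f w - g w)%:E| = \int[mu]_(w in E) (f w - g w)%:E)%E.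
    apply: eq_integral => w; rewrite inE /E /= => fgw.
    by rewrite ger0_norm// -opprB oppr_ge0 ltW.
  have fgE : mu.-integrable E (EFin \o (fun w => f w - g w)).
    exact: (integrableB mE fE gE).
  rewrite -[LHS]fineK; last exact: integrable_fin_num.
  congr EFin; apply/eqP; rewrite eq_le; apply/andP; split.
    by have := fg _ mE; rewrite -subr_le0 -RintegralB.
  apply: Rintegral_ge0 => w; rewrite /E /= => fgw.
  by rewrite -opprB oppr_ge0 ltW.
have /(ae_eq_integral_abs mu mE) [+ _] : measurable_fun E (fun w => (f w - g w)%:E).
  by apply: measurable_funTS; apply/measurable_EFinP; exact: measurable_funB.
move=> /(_ I0); apply: filterS => w Ew; rewrite leNgt; apply/negP => gf.
have Ew' : E w by rewrite /E /= subr_lt0.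
by have [/eqP] := Ew Ew'; rewrite subr_eq0 => /eqP fgw; move: gf; rewrite fgw ltxx.
Qed.

Lemma ae_eq_Rintegral (f g : T -> R) : measurable_fun setT f -> measurable_fun setT g ->
  {ae mu, forall w, f w = g w} -> \int[mu]_w f w = \int[mu]_w g w.
Proof.
move=> mf mg fg; congr fine; apply: ae_eq_integral => //.
- exact/measurable_EFinP.
- exact/measurable_EFinP.
- by apply: filterS fg => w ->.
Qed.

Lemma ae_eq_integrable (f g : T -> R) : measurable_fun setT f ->
  {ae mu, forall w, f w = g w} ->
  mu.-integrable setT (EFin \o g) -> mu.-integrable setT (EFin \o f).
Proof.
move=> mf fg /integrableP[mg gi]; apply/integrableP; split; first exact/measurable_EFinP.
rewrite (ge0_ae_eq_integral _ _ _ _ (g := fun w => `|(EFin \o g) w|%E))//.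
- by apply: measurableT_comp => //; exact/measurable_EFinP.
- exact: measurableT_comp.
- by apply: filterS fg => w /= ->.
Qed.

Lemma ae_measurable_null (P : T -> Prop) : {ae mu, forall w, P w} ->
  exists N, [/\ measurable N, mu N = 0%E & forall w, ~ N w -> P w].
Proof.
by move=> [N [mN N0 PN]]; exists N; split=> // w Nw; apply: contrapT => /PN.
Qed.

Lemma null_ae (N : set T) : measurable N -> mu N = 0%E -> {ae mu, forall w, ~ N w}.
Proof. by move=> mN N0; exists N; split=> // w /= /contrapT. Qed.

Lemma LinftyM (z : R[i]) (g : T -> R[i]^o) :
  Linfty mu g -> Linfty mu (fun w => z * g w : R[i]^o).
Proof.
move=> [mg [M gM]]; have [q dq] := @complex_dense_seq R; split.
  apply: (borel_measurableZ dq (f := g)) => //; exact: borel_measurable_cst.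
exists (rnorm (z : R[i]^o) * M); apply: filterS gM => w gM.
by rewrite rnormM ler_wpM2l ?rnorm_ge0.
Qed.

Lemma L2_Linfty V (a : nat -> V) g (f : T -> V) : dense_seq a -> Linfty mu g ->
  L2 mu f -> L2 mu (fun w => g w *: f w).
Proof.
move=> da [mg [M gM]] fL; have [mf _] := fL.
have [||//] := @L2_dominated _ _ (fun w => g w *: f w) f `|M| (normr_ge0 _) _ fL.
  exact: borel_measurableZ da _ _ mg mf.
apply: filterS gM => w gM; rewrite rnormZ ler_wpM2r ?rnorm_ge0//.
exact: le_trans gM (ler_norm _).
Qed.

(** Cut [g] off outside [{|g| < |M| + 1}], a measurable set of full measure; the margin 1 allows a
    strict inequality. *)
Lemma Linfty_ReIm (g : T -> R[i]^o) : Linfty mu g ->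
  exists g1 g2 : T -> R, [/\ bounded_measurable g1, bounded_measurable g2 &
    {ae mu, forall w, g w = Complex (g1 w) (g2 w)}].
Proof.
move=> [mg [M gM]]; pose E := [set w | rnorm (g w) < `|M| + 1].
have mE : measurable E by apply: measurable_lt; exact: borel_measurable_rnorm.
have mi : measurable_fun setT (\1_E : T -> R) by exact: measurable_indic.
exists (fun w => \1_E w * complex.Re (g w)), (fun w => \1_E w * complex.Im (g w)).
have bound (x : R) w : `|x| <= rnorm (g w) -> `|\1_E w * x| <= `|M| + 1.
  move=> xg; rewrite normrM indicE; have [/set_mem Ew|_] := boolP (w \in E).
    by rewrite normr1 mul1r (le_trans xg)// ltW.
  by rewrite normr0 mul0r addr_ge0.
split.
- split; first by apply: measurable_funM => //; exact: borel_measurable_Re.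
  by exists (`|M| + 1) => w; apply: bound; exact: Re_le_rnorm.
- split; first by apply: measurable_funM => //; exact: borel_measurable_Im.
  by exists (`|M| + 1) => w; apply: bound; exact: Im_le_rnorm.
apply: filterS gM => w gM; rewrite indicE mem_set ?mul1r; first by case: (g w).
by apply: le_lt_trans (le_trans gM (ler_norm M)) _; rewrite ltrDl.
Qed.

Lemma measurable_ReM (g f : T -> R[i]^o) : borel_measurable g -> borel_measurable f ->
  measurable_fun setT (fun w => complex.Re (g w * f w)).
Proof.
move=> mg mf; have [q dq] := @complex_dense_seq R.
exact/borel_measurable_Re/(borel_measurableZ dq mg mf).
Qed.

Lemma integrable_ReM (g f : T -> R[i]^o) : Linfty mu g -> borel_measurable f ->
  mu.-integrable setT (EFin \o (fun w => complex.Re (f w))) ->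
  mu.-integrable setT (EFin \o (fun w => complex.Im (f w))) ->
  mu.-integrable setT (EFin \o (fun w => complex.Re (g w * f w))).
Proof.
move=> gL mf Ref Imf; have [mg _] := gL.
have [g1 [g2 [bg1 bg2 gg]]] := Linfty_ReIm gL.
apply: (@ae_eq_integrable _
    (fun w => g1 w * complex.Re (f w) - g2 w * complex.Im (f w))).
- exact: measurable_ReM.
- by apply: filterS gg => w ->; case: (f w).
- exact: (integrableB measurableT (integrable_bounded_mul bg1 Ref)
    (integrable_bounded_mul bg2 Imf)).
Qed.

End L2_theory.

(** Weight the indicators of a cover by sets of finite measure with
    [c n = 2^-(n+1) / (1 + mu (F n))]. Both the supremum and the integral of the sum are then at
    most the sum of the [2^-(n+1)], that is 1; positivity holds because the [F n] cover. Values in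
    []0, 1]] give [eta^2 <= eta], hence square integrability. *)
Lemma sigma_finite_density d (T : measurableType d) (R : realType)
    (mu : {sigma_finite_measure set T -> \bar R}) :
  exists eta : T -> R, [/\ measurable_fun setT eta, forall w, 0 < eta w <= 1 &
    mu.-integrable setT (EFin \o (fun w => eta w ^+ 2))].
Proof.
have [F FT Ff] := sigma_finiteT mu.
pose c n : R := (2 ^ n.+1)%:R^-1 / (1 + fine (mu (F n))).
have mu1 n : 1 <= 1 + fine (mu (F n)) by rewrite lerDl fine_ge0.
have c0 n : 0 < c n by rewrite divr_gt0 ?invr_gt0 ?ltr0n ?expn_gt0// (lt_le_trans ltr01).
have c_le n : c n <= 1 / (2 ^ n.+1)%:R.
  rewrite div1r ler_piMr ?invr_ge0// invf_le1//.
  exact: lt_le_trans ltr01 (mu1 n).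
pose g n w : \bar R := (c n * \1_(F n) w)%:E.
have g0 n w : (0 <= g n w)%E by rewrite lee_fin mulr_ge0 ?(ltW (c0 n)).
have mg n : measurable_fun setT (g n).
  apply/measurable_EFinP; apply: measurable_funM => //.
  by apply: measurable_indic; have [] := Ff n.
pose G w : \bar R := (\sum_(n <oo) g n w)%E.
have half_sum : (\sum_(i <oo) (1 / (2 ^ i.+1)%:R)%:E <= 1%:E :> \bar R)%E.
  exact: (@epsilon_trick0 R 1 xpredT ler01).
have G1 w : (G w <= 1)%E.
  apply: le_trans half_sum.
  apply: lee_nneseries => // n _; rewrite lee_fin (le_trans _ (c_le n))//.
  by rewrite ler_piMr ?(ltW (c0 n))// indicE; case: (_ \in _).
have G0 w : (0 < G w)%E.
  have [n _ Fnw] : (\bigcup_n F n) w by rewrite -FT.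
  apply: (@lt_le_trans _ _ (g n w)); first by rewrite lte_fin indicE mem_set// mulr1.
  apply: le_trans (nneseries_lim_ge n.+1 _) => [|k _ _]; last exact: g0.
  by rewrite big_nat_recr//= leeDr// sume_ge0.
have Gfin w : G w \is a fin_num.
  by rewrite ge0_fin_numE ?(ltW (G0 w))// (le_lt_trans (G1 w)) ?ltry.
have mG : measurable_fun setT G by apply: ge0_emeasurable_sum => //.
have GT : (\int[mu]_w G w <= 1)%E.
  rewrite integral_nneseries//.
  apply: le_trans half_sum.
  apply: lee_nneseries => [n _ _|n _]; first exact: integral_ge0.
  have [mF Foo] := Ff n.
  under eq_integral do rewrite /g EFinM.
  rewrite ge0_integralZl_EFin//; last exact: ltW.
  - rewrite integral_indic// setIT -[X in (_ * X)%E]fineK ?ge0_fin_numE//.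
    rewrite -EFinM lee_fin /c -mulrA div1r ler_piMr ?invr_ge0//.
    rewrite mulrC ler_pdivrMr ?mul1r ?lerDr//.
    exact: lt_le_trans ltr01 (mu1 n).
  - by apply/measurable_EFinP; exact: measurable_indic.
have Gi : mu.-integrable setT G.
  apply/integrableP; split=> //.
  under eq_integral do rewrite gee0_abs ?(ltW (G0 _))//.
  by rewrite (le_lt_trans GT) ?ltry.
have mfG : measurable_fun setT (fine \o G) by exact: measurableT_comp.
have fG01 w : 0 < fine (G w) <= 1.
  by rewrite fine_gt0 ?G0 ?ltey_eq ?Gfin//= -lee_fin fineK.
exists (fine \o G); split=> //.
apply: le_integrable Gi => //.
  by apply/measurable_EFinP; exact: measurable_funX.
move=> w _ /=; rewrite -[in leRHS](fineK (Gfin w)) /= lee_fin.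
have /andP[f0 f1] := fG01 w.
by rewrite !ger0_norm ?sqr_ge0 ?(ltW f0)// expr2 ler_piMr// ltW.
Qed.

(** * Bounded operators on a closed subspace *)

Section bounded_linear_theory.
Context {R : realType} (H : completeNormedModType R[i]).
Variable dot : {dot H for @Num.conj R[i]}.
Hypothesis dotE : induces_norm dot.
Variable S : set H.
Hypothesis cS : closed_subspace S.

Section bounded_linear_on.
Context (f : H -> H) (blf : bounded_linear_on S f).

Lemma bounded_linear_on0 : f 0 = 0.
Proof.
have [+ _] := blf; move=> /(_ 1 0 0 (closed_subspace0 cS) (closed_subspace0 cS)).
rewrite scaler0 addr0 scale1r => /eqP.
by rewrite -[X in X == _]addr0 (inj_eq (addrI _)) eq_sym => /eqP.
Qed.

Lemma bounded_linear_onZ (z : R[i]) x : S x -> f (z *: x) = z *: f x.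
Proof.
move=> Sx; have [/(_ z x 0 Sx (closed_subspace0 cS))] := blf.
by rewrite !addr0 bounded_linear_on0 addr0.
Qed.

Lemma bounded_linear_onB x y : S x -> S y -> f (x - y) = f x - f y.
Proof.
move=> Sx Sy; have [/(_ (-1) y x Sy Sx)] := blf.
by rewrite !scaleN1r (addrC _ x) (addrC _ (f x)).
Qed.

Lemma bounded_linear_on_bound :
  exists2 B : R, 0 <= B & forall v, S v -> rnorm (f v) <= B * rnorm v.
Proof.
have [_ [B fB]] := blf; exists `|B| => // v Sv.
by rewrite (le_trans (fB v Sv))// ler_wpM2r ?rnorm_ge0 ?ler_norm.
Qed.

Lemma opnorm_on_le (M : R) : 0 <= M ->
  (opnorm_on S f <= M%:E)%E <-> forall v, S v -> rnorm (f v) <= M * rnorm v.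
Proof.
move=> M0; split=> [fM v Sv|fM]; last first.
  apply: ge_ereal_sup => _ [v [Sv v1] <-]; rewrite lee_fin.
  by rewrite (le_trans (fM v Sv))// ler_piMr.
have [/eqP|v0] := eqVneq (rnorm v) 0.
  by move=> /eqP/rnorm_eq0 ->; rewrite bounded_linear_on0 !rnorm0 mulr0.
have vp : 0 < rnorm v by rewrite lt_def v0 rnorm_ge0.
pose z := real_complex R (rnorm v)^-1.
have zv : rnorm (z : R[i]^o) = (rnorm v)^-1.
  by rewrite rnorm_real ger0_norm// invr_ge0 rnorm_ge0.
have : ((rnorm (f (z *: v)))%:E <= opnorm_on S f)%E.
  apply: ereal_sup_ubound; exists (z *: v) => //; split.
    exact: closed_subspaceZ.
  by rewrite rnormZ zv mulVf.
move=> /le_trans/(_ fM); rewrite lee_fin bounded_linear_onZ// rnormZ zv.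
by rewrite mulrC ler_pdivrMr.
Qed.

End bounded_linear_on.

Section dense.
Variable a : nat -> H.
Hypothesis da : dense_seq a.
Local Notation P := (orthproj dot S).

(** The projection is 1-Lipschitz and fixes [S], so it maps a dense sequence of [H] to a dense
    sequence of [S]. *)
Lemma orthproj_dense v (e : R) : S v -> 0 < e -> exists n, rnorm (v - P (a n)) < e.
Proof.
move=> Sv e0; have [n vn] := da v e0; exists n; apply: le_lt_trans vn.
by have := orthproj_lip dotE cS v (a n); rewrite (orthproj_id dotE cS Sv).
Qed.

(** The unspecified bound [B] of [f] only supplies continuity; the limit along the dense sequence
    retains the sharp constant [M]. *)
Lemma bounded_linear_on_dense (f : H -> H) (M : R) : bounded_linear_on S f -> 0 <= M ->
  (forall n, rnorm (f (P (a n))) <= M * rnorm (P (a n))) ->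
  forall v, S v -> rnorm (f v) <= M * rnorm v.
Proof.
move=> blf M0 fM v Sv; have [B B0 fB] := bounded_linear_on_bound blf.
apply/ler_addgt0Pr => e e0.
have BM : 0 < B + M + 1 by lra.
have [n vn] := orthproj_dense Sv (divr_gt0 e0 BM).
set p := P (a n) in vn; have Sp : S p by exact: orthprojS.
have := rnormD (f v - f p) (f p); rewrite subrK -bounded_linear_onB//.
have := fB _ (closed_subspaceB cS Sv Sp); have := fM n; rewrite -/p.
have : M * rnorm p <= M * (rnorm v + rnorm (v - p)).
  by rewrite ler_wpM2l// -{1}[p](subKr v) (le_trans (rnormD _ _))// rnormN.
have : (B + M) * rnorm (v - p) <= e.
  apply: (@le_trans _ _ ((B + M + 1) * (e / (B + M + 1)))).
    by apply: ler_pM; rewrite ?rnorm_ge0 ?addr_ge0 ?lerDl// ltW.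
  by rewrite mulrC divfK// gt_eqF.
rewrite mulrDl mulrDr; lra.
Qed.

(** The preceding estimate for [f - g] with constant 0. *)
Lemma bounded_linear_on_eq (f g : H -> H) : bounded_linear_on S f -> bounded_linear_on S g ->
  (forall n, f (P (a n)) = g (P (a n))) -> forall v, S v -> f v = g v.
Proof.
move=> blf blg fg v Sv.
have [B B0 fB] := bounded_linear_on_bound blf.
have [C C0 gC] := bounded_linear_on_bound blg.
have bl : bounded_linear_on S (fun v => f v - g v).
  split=> [z x y Sx Sy|].
    have [-> // _] := blf; have [-> // _] := blg.
    by rewrite scalerBr opprD addrACA.
  exists (B + C) => x Sx; rewrite (le_trans (rnormD _ _))// rnormN mulrDl.
  by rewrite lerD ?fB ?gC.
have := @bounded_linear_on_dense _ 0 bl (lexx 0).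
move=> /(_ _ v Sv); rewrite mul0r => h.
apply/eqP; rewrite -subr_eq0; apply/eqP/rnorm_eq0/eqP.
by rewrite eq_le rnorm_ge0 andbT h// => n; rewrite fg subrr rnorm0 mul0r.
Qed.

Lemma rnorm_lincombB (z q : R[i]) (x y p r : H) :
  rnorm (z *: x + y - (q *: p + r)) <=
  rnorm (z - q : R[i]^o) * rnorm x + rnorm (q : R[i]^o) * rnorm (x - p) + rnorm (y - r).
Proof.
have -> : z *: x + y - (q *: p + r) = (z - q) *: x + q *: (x - p) + (y - r).
  by rewrite scalerBl scalerBr (addrA _ (q *: x)) subrK opprD addrACA.
apply: le_trans (rnormD _ _) _; rewrite lerD2r.
by apply: le_trans (rnormD _ _) _; rewrite !rnormZ.
Qed.

Variables (q : nat -> R[i]^o) (F : nat -> H) (M : R).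
Hypothesis dq : dense_seq q.
Hypothesis M0 : 0 <= M.
Hypothesis FB : forall n m, rnorm (F n - F m) <= M * rnorm (P (a n) - P (a m)).
(** The combination need not be one of the points [P (a k)], so it is compared with all of them. *)
Hypothesis FDZ : forall k j n m, rnorm (F k - (q j *: F n + F m)) <=
  M * rnorm (P (a k) - ((q j : R[i]) *: P (a n) + P (a m))).

(* The continuous extension to [S] of the densely defined map [P (a n) |-> F n]. *)
Definition dense_ext v : H :=
  xget 0 [set y | forall n, rnorm (y - F n) <= M * rnorm (v - P (a n))].

(** The default of [xget] is never taken: along indices [k m] with [P (a (k m))] tending to [v], the
    values [F (k m)] are Cauchy by [FB], and their limit satisfies every inequality. *)
Lemma dense_extP v n : S v -> rnorm (dense_ext v - F n) <= M * rnorm (v - P (a n)).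
Proof.
move=> Sv; rewrite /dense_ext; case: xgetP => [y _|noext]; [exact|exfalso].
have inv0 m : (0 : R) < m.+1%:R^-1 by rewrite invr_gt0.
pose k m := sval (cid (orthproj_dense Sv (inv0 m))).
have kv m : rnorm (v - P (a (k m))) < m.+1%:R^-1 by rewrite /k; case: cid.
have M1 : 0 < 2 * (M + 1) by rewrite mulr_gt0// ltr_wpDl.
have kv_small (e : R) : 0 < e -> exists N, forall m, (N <= m)%N ->
    M * rnorm (v - P (a (k m))) < e / 2.
  move=> e0; have d0 := divr_gt0 e0 M1.
  exists (Num.bound (e / (2 * (M + 1)))^-1) => m Nm.
  have : (m.+1%:R^-1 : R) < e / (2 * (M + 1)).
    rewrite invf_plt ?posrE//; apply: lt_le_trans (archi_boundP _) _.
      by rewrite invr_ge0 ltW.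
    by rewrite ler_nat leqW.
  move=> /(lt_trans (kv m)) h.
  apply: (@le_lt_trans _ _ (M * (e / (2 * (M + 1))))).
    by rewrite ler_wpM2l// ltW.
  rewrite (_ : _ * _ = e / 2 * (M / (M + 1))); last first.
    by field; rewrite gt_eqF// ltr_wpDl.
  by rewrite -[ltRHS]mulr1 ltr_pM2l ?divr_gt0// ltr_pdivrMr ?ltr_wpDl// mul1r ltrDl.
have [|l ul] := complete_rnorm (u := F \o k).
  move=> e /kv_small[N Ne]; exists N => m1 m2 /Ne h1 /Ne h2 /=.
  apply: le_lt_trans (FB _ _) _.
  have := rnorm_dist (P (a (k m1))) v (P (a (k m2))).
  by rewrite (rnormC _ v) => /(ler_wpM2l M0); lra.
apply: (noext l) => m; apply/ler_addgt0Pr => e e0.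
have [N1 N1e] := ul _ (divr_gt0 e0 (ltr0n _ 2)).
have [N2 N2e] := kv_small _ e0.
have {}N1e := N1e _ (leq_maxl N1 N2); have {}N2e := N2e _ (leq_maxr N1 N2).
have := rnorm_dist l (F (k (maxn N1 N2))) (F m).
have := FB (k (maxn N1 N2)) m.
have := rnorm_dist (P (a (k (maxn N1 N2)))) v (P (a m)).
move=> /(ler_wpM2l M0); rewrite mulrDr (rnormC _ v) (rnormC l (F (k _))).
by move: N1e => /=; lra.
Qed.

(** When [P (a n)] is close to [v], both [y] and the extension are close to the same [F n]. *)
Lemma dense_ext_unique v y : S v ->
  (forall n, rnorm (y - F n) <= M * rnorm (v - P (a n))) -> y = dense_ext v.
Proof.
move=> Sv yF; apply/eqP; rewrite -subr_eq0; apply/eqP/rnorm_eq0/eqP.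
rewrite eq_le rnorm_ge0 andbT; apply/ler_addgt0Pr => e e0; rewrite add0r.
have M1 : 0 < 2 * M + 1 by rewrite ltr_wpDl// mulr_ge0.
have [n vn] := orthproj_dense Sv (divr_gt0 e0 M1).
have := rnorm_dist y (F n) (dense_ext v); rewrite (rnormC (F n)).
have := yF n; have := dense_extP n Sv.
have : (2 * M) * rnorm (v - P (a n)) <= e.
  apply: (@le_trans _ _ ((2 * M + 1) * (e / (2 * M + 1)))).
    by apply: ler_pM; rewrite ?rnorm_ge0 ?mulr_ge0 ?lerDl// ltW.
  by rewrite mulrC divfK// gt_eqF.
by rewrite -mulrA; lra.
Qed.

(** Approximate [x], [y], [z *: x + y] by projected points and [z] by some [q j], all within [dl];
    then [FDZ] compares the corresponding values of [F]. *)
Lemma dense_ext_bounded_linear : bounded_linear_on S dense_ext.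
Proof.
have lin (z : R[i]) x y : S x -> S y ->
    dense_ext (z *: x + y) = z *: dense_ext x + dense_ext y.
  move=> Sx Sy; have Sz := closed_subspaceDZ cS z Sx Sy.
  apply/eqP; rewrite -subr_eq0; apply/eqP/rnorm_eq0/eqP.
  rewrite eq_le rnorm_ge0 andbT; apply/ler_addgt0Pr => e e0; rewrite add0r.
  set nz := rnorm (z : R[i]^o).
  have nz0 : 0 <= nz by exact: rnorm_ge0.
  (* The coefficients of [dl] in three errors: from the value at [z *: x + y] to [F k], from [F k]
     to [q j *: F n + F m], and from there to the combination of values. The last 1 ensures
     positivity; [dl <= 1] serves to bound [|q j|] by [nz + 1]. *)
  pose K := M + M * (1 + (rnorm x + (nz + 1) + 1)) +
    (rnorm (dense_ext x) + (nz + 1) * M + M) + 1.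
  have K0 : 0 < K.
    by rewrite ltr_wpDl// !addr_ge0 ?mulr_ge0 ?addr_ge0 ?rnorm_ge0.
  have d0 : 0 < Num.min 1 (e / K) by rewrite lt_min ltr01 divr_gt0.
  set dl := Num.min 1 (e / K) in d0.
  have d1 : dl <= 1 by rewrite ge_min lexx.
  have dK : dl * K <= e by rewrite -ler_pdivlMr// ge_min lexx orbT.
  have [n xn] := orthproj_dense Sx d0; have [m ym] := orthproj_dense Sy d0.
  have [k zk] := orthproj_dense Sz d0; have [j zj] := dq z d0.
  have qj : rnorm (q j) <= nz + 1.
    have := rnormD (z : R[i]^o) (q j - z); rewrite addrC subrK => h.
    by apply: le_trans h _; rewrite lerD2l (le_trans _ d1)// rnormC ltW.
  have qM : rnorm (q j) * rnorm (x - P (a n)) <= (nz + 1) * dl.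
    by apply: ler_pM; rewrite ?rnorm_ge0// ltW.
  have zx : rnorm (z - q j : R[i]^o) * rnorm x <= dl * rnorm x.
    by rewrite ler_wpM2r ?rnorm_ge0// ltW.
  have h1 := dense_extP k Sz.
  have h1' : M * rnorm (z *: x + y - P (a k)) <= M * dl by rewrite ler_wpM2l// ltW.
  have h2 := FDZ k j n m.
  have h2' : rnorm (P (a k) - ((q j : R[i]) *: P (a n) + P (a m))) <=
      dl + (dl * rnorm x + (nz + 1) * dl + dl).
    apply: le_trans (rnorm_dist _ (z *: x + y) _) _.
    apply: lerD; first by rewrite rnormC ltW.
    apply: le_trans (rnorm_lincombB _ _ _ _ _ _) _.
    by rewrite !lerD// ltW.
  have h2'' := ler_wpM2l M0 h2'.
  have h3 : rnorm (z *: dense_ext x + dense_ext y - (q j *: F n + F m)) <=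
      dl * rnorm (dense_ext x) + (nz + 1) * (M * dl) + M * dl.
    apply: le_trans (rnorm_lincombB _ _ _ _ _ _) _.
    apply: lerD; first apply: lerD.
    - by rewrite ler_wpM2r ?rnorm_ge0// ltW.
    - apply: ler_pM; rewrite ?rnorm_ge0//.
      by apply: le_trans (dense_extP n Sx) _; rewrite ler_wpM2l// ltW.
    - by apply: le_trans (dense_extP m Sy) _; rewrite ler_wpM2l// ltW.
  apply: le_trans (rnorm_dist _ (F k) _) _.
  have := rnorm_dist (F k) (q j *: F n + F m) (z *: dense_ext x + dense_ext y).
  rewrite (rnormC (q j *: F n + F m)).
  move: h1 h1' h2 h2'' h3 dK; rewrite /K.
  set A1 := rnorm _; set A2 := rnorm (_ - P (a k)); set A3 := rnorm _.
  set A4 := rnorm _; set A5 := rnorm _; set A6 := rnorm _ => *.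
  by nra.
split=> //; exists M => v Sv.
have ext0 : dense_ext 0 = 0.
  have := lin 1 0 0 (closed_subspace0 cS) (closed_subspace0 cS).
  rewrite scaler0 addr0 scale1r => /eqP.
  by rewrite -[X in X == _]addr0 (inj_eq (addrI _)) eq_sym => /eqP.
(* Compare the values at [v] and at 0 through an [F n] with [P (a n)] close to 0; the error is
   [2 * M * rnorm (P (a n))]. *)
rewrite -[dense_ext v]subr0 -ext0.
apply/ler_addgt0Pr => e e0; have M1 : 0 < 2 * M + 1 by rewrite ltr_wpDl// mulr_ge0.
have [n vn] := orthproj_dense (closed_subspace0 cS) (divr_gt0 e0 M1).
apply: le_trans (rnorm_dist _ (F n) _) _; rewrite (rnormC (F n)).
have := dense_extP n Sv; have := dense_extP n (closed_subspace0 cS).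
have := rnorm_dist v 0 (P (a n)); rewrite subr0 => /(ler_wpM2l M0).
have : (2 * M) * rnorm (0 - P (a n)) <= e.
  apply: (@le_trans _ _ ((2 * M + 1) * (e / (2 * M + 1)))).
    by apply: ler_pM; rewrite ?rnorm_ge0 ?mulr_ge0 ?lerDl// ltW.
  by rewrite mulrC divfK// gt_eqF.
by rewrite -mulrA mulrDr; lra.
Qed.

End dense.
End bounded_linear_theory.

(** * Operators on multiplicatively invariant spaces *)

Lemma sqnormZ d (T : measurableType d) (R : realType) (mu : {measure set T -> \bar R})
    (V : normedModType R[i]) (c : R) (f : T -> V) : L2 mu f ->
  sqnorm mu (fun w => real_complex R c *: f w) = c ^+ 2 * sqnorm mu f.
Proof.
move=> /L2P[_ fi]; rewrite /sqnorm -RintegralZl//; apply: eq_Rintegral => w _.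
by rewrite rnormZ rnorm_real exprMn real_normK ?num_real.
Qed.

Section operators.
Context (R : realType) (d : measure_display) (Omega : measurableType d).
Variable mu : {sigma_finite_measure set Omega -> \bar R}.
Variables (H : completeNormedModType R[i]) (dot : {dot H for @Num.conj R[i]}).
Variables (W : set (Omega -> H)) (J : Omega -> set H).
Hypothesis dotE : induces_norm dot.
Variable a : nat -> H.
Hypothesis da : dense_seq a.
Hypothesis cW : closed_subspace_L2 mu W.
Hypothesis WJ : corresponding_range_function mu dot W J.
Local Notation C r := (real_complex R r).
Local Notation P w := (orthproj dot (J w)).

Let cJ w : closed_subspace (J w). Proof. by have [[]] := WJ. Qed.

Let WP phi : W phi <-> L2 mu phi /\ {ae mu, forall w, J w (phi w)}.
Proof. by have [_ ->] := WJ. Qed.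

Let WL2 phi : W phi -> L2 mu phi. Proof. by move=> /WP[]. Qed.

Let Wborel phi : W phi -> borel_measurable phi. Proof. by move=> /WL2[]. Qed.

Let WDZ (z : R[i]) phi psi : W phi -> W psi -> W (z *: phi + psi).
Proof.
by move=> Wphi Wpsi; have [_ [_ h] _] := cW; apply/set_mem/h; exact: mem_set.
Qed.

Let WZ (z : R[i]) phi : W phi -> W (z *: phi).
Proof.
by move=> Wphi; have [_ [/set_mem W0 _] _] := cW; have := WDZ z Wphi W0; rewrite addr0.
Qed.

Let WB phi psi : W phi -> W psi -> W (fun w => phi w - psi w).
Proof.
move=> Wphi Wpsi; have := WDZ (-1) Wpsi Wphi; congr W; apply/funext => w.
by rewrite /= addrC; congr (_ + _); exact: scaleN1r.
Qed.

(** Each [J w] is a subspace, so pointwise multiples stay in it. This is what makes [U (h phi)]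
    meaningful for every bounded [h]. *)
Lemma mult_invariant_Linfty g phi : Linfty mu g -> W phi -> W (fun w => g w *: phi w).
Proof.
move=> gL Wphi; have [phiL phiJ] := (WP phi).1 Wphi; apply/WP; split; last first.
  by apply: filterS phiJ => w; exact: closed_subspaceZ.
exact: L2_Linfty da _ phiL.
Qed.

Lemma bounded_measurable_Linfty (f : Omega -> R) : bounded_measurable f ->
  Linfty mu (fun w => C (f w)).
Proof.
move=> [mf [K fK]]; split; first exact: borel_measurable_complex.
by exists K; apply: nearW => w; rewrite rnorm_real.
Qed.

Section bounded_operator.
Variable U : (Omega -> H) -> (Omega -> H).
Hypothesis bU : bounded_operator mu W U.

Let UL2 phi : W phi -> L2 mu (U phi). Proof. by have [h _ _ _] := bU; exact: h. Qed.

Let Uborel phi : W phi -> borel_measurable (U phi). Proof. by move=> /UL2[]. Qed.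

Lemma bounded_operator_ae phi psi : W phi -> W psi ->
  {ae mu, forall w, phi w = psi w} -> {ae mu, forall w, U phi w = U psi w}.
Proof. by have [_ h _ _] := bU; exact: h. Qed.

Lemma bounded_operatorDZ (z : R[i]) phi psi : W phi -> W psi ->
  {ae mu, forall w, U (fun w => z *: phi w + psi w) w = z *: U phi w + U psi w}.
Proof. by move=> Wphi Wpsi; have [_ _ h _] := bU; exact: (h z phi psi Wphi Wpsi). Qed.

Lemma bounded_operatorZ (z : R[i]) phi : W phi ->
  {ae mu, forall w, U (fun w => z *: phi w) w = z *: U phi w}.
Proof.
move=> Wphi; have W0 := WZ 0 Wphi.
have := bounded_operatorDZ z Wphi W0.
(* Linearity comes in the form [a *: phi + psi]; with [psi = 0 *: phi] one needs [U psi = 0] a.e.,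
   which follows from [psi = - psi + psi]. *)
have := bounded_operatorDZ (-1) W0 W0.
have <- : (fun w => 0 *: phi w) = (fun w => -1 *: (0 *: phi w) + 0 *: phi w).
  by apply/funext => w; rewrite !scale0r scaler0 addr0.
have -> : (fun w => z *: phi w + 0 *: phi w) = (fun w => z *: phi w).
  by apply/funext => w; rewrite scale0r addr0.
by apply: filterS2 => w; rewrite scaleN1r addNr => -> ->; rewrite addr0.
Qed.

Lemma bounded_operatorB phi psi : W phi -> W psi ->
  {ae mu, forall w, U (fun w => phi w - psi w) w = U phi w - U psi w}.
Proof.
move=> Wphi Wpsi; apply: filterS (bounded_operatorDZ (-1) Wpsi Wphi) => w.
under eq_fun do rewrite scaleN1r addrC.
by move=> ->; rewrite scaleN1r addrC.
Qed.

Lemma bounded_operator_sqnorm : exists2 M : R, 0 <= M &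
  forall phi, W phi -> sqnorm mu (U phi) <= M ^+ 2 * sqnorm mu phi.
Proof.
have [_ _ _ [M UM]] := bU; exists `|M| => // phi Wphi.
apply/(L2norm_le (normr_ge0 M) (UL2 Wphi) (WL2 Wphi)).
apply: le_trans (UM _ Wphi) _; apply: lee_wpmul2r; first exact: Lnorm_ge0.
by rewrite lee_fin ler_norm.
Qed.

Lemma integrable_redot (phi psi : Omega -> H) : L2 mu phi -> L2 mu psi ->
  mu.-integrable setT (EFin \o (fun w => redot dot (phi w) (psi w))).
Proof.
move=> /L2P[mphi iphi] /L2P[mpsi ipsi].
apply: (@le_integrable _ _ _ mu setT measurableT _
  ((fun w => (rnorm (phi w) ^+ 2)%:E) \+ (fun w => (rnorm (psi w) ^+ 2)%:E))%E).
- by apply/measurable_EFinP; exact: (measurable_redot dotE da).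
- move=> w _ /=; rewrite lee_fin [leRHS]ger0_norm ?addr_ge0 ?sqr_ge0//.
  by have := redot_le dotE (phi w) (psi w) (@ltr01 R); rewrite invr1 !mul1r addrC.
- exact: integrableD.
Qed.

(** * Densities of the functionals [h |-> Re <U(h phi), psi>] *)

Section density.
Variables (phi : Omega -> H).
Hypothesis Wphi : W phi.

Let Wmul (f : Omega -> R) : bounded_measurable f -> W (fun w => C (f w) *: phi w).
Proof. by move=> bf; exact: (mult_invariant_Linfty (bounded_measurable_Linfty bf)). Qed.

(* Radon-Nikodym replaces the adjoint of [U]: morally [r = Re <phi, U^* psi>]. *)
Lemma operator_real_density psi : L2 mu psi ->
  exists2 r : Omega -> R, mu.-integrable setT (EFin \o r) &
    forall f, bounded_measurable f ->
      \int[mu]_w redot dot (U (fun w => C (f w) *: phi w) w) (psi w) = \int[mu]_w (f w * r w).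
Proof.
move=> Lpsi; have [M M0 UM] := bounded_operator_sqnorm.
have [mphi iphi] := (L2P mu phi).1 (WL2 Wphi).
have [mpsi ipsi] := (L2P mu psi).1 Lpsi.
(* [redot_le] gives [t |psi|^2 + t^-1 |U(f phi)|^2], and boundedness of [U] gives
   [|U(f phi)|^2 <= M^2 \int f^2 |phi|^2]; these are the [c], [C] and [v] supplied. *)
apply: (functional_density (v := fun w => rnorm (phi w) ^+ 2) (c := sqnorm mu psi)
  (C := M ^+ 2)) => //.
- by move=> w; exact: sqr_ge0.
- exact: sqr_ge0.
- move=> k f g bf bg.
  have [Wf Wg] := (Wmul bf, Wmul bg).
  have Wfg := Wmul (bounded_measurableDZ k bf bg).
  rewrite -RintegralZl//; last exact: integrable_redot (UL2 Wf) _.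
  rewrite -RintegralD//; last 2 first.
  + exact: (@integrableZl _ _ _ mu setT measurableT k _ (integrable_redot (UL2 Wf) Lpsi)).
  + exact: integrable_redot (UL2 Wg) _.
  apply: ae_eq_Rintegral.
  + exact: (measurable_redot dotE da (Uborel Wfg)).
  + apply: measurable_funD; last exact: (measurable_redot dotE da (Uborel Wg)).
    by apply: measurable_funM => //; exact: (measurable_redot dotE da (Uborel Wf)).
  + have := bounded_operatorDZ (C k) Wf Wg.
    have -> : (fun w => C k *: (C (f w) *: phi w) + C (g w) *: phi w) =
              (fun w => C (k * f w + g w) *: phi w).
      by apply/funext => w; rewrite scalerA -scalerDl -rmorphM -rmorphD.
    by apply: filterS => w ->; rewrite redotDl redotZl.
move=> f t bf t0; have Wf := Wmul bf.
apply: le_trans (le_normr_Rintegral measurableT (integrable_redot (UL2 Wf) Lpsi)) _.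
have [mU iU] := (L2P mu _).1 (UL2 Wf).
apply: (@le_trans _ _ (\int[mu]_w (t * rnorm (psi w) ^+ 2 +
    t^-1 * rnorm (U (fun w => C (f w) *: phi w) w) ^+ 2))).
  apply: le_Rintegral => //.
  - exact: (integrable_norm (integrable_redot (UL2 Wf) Lpsi)).
  - exact: (@integrableD _ _ _ mu setT measurableT _ _
      (@integrableZl _ _ _ mu setT measurableT t _ ipsi)
      (@integrableZl _ _ _ mu setT measurableT t^-1 _ iU)).
  - by move=> w _; exact: redot_le.
rewrite RintegralD//; last 2 first.
- exact: (@integrableZl _ _ _ mu setT measurableT t _ ipsi).
- exact: (@integrableZl _ _ _ mu setT measurableT t^-1 _ iU).
rewrite !RintegralZl// lerD2l ler_wpM2l ?invr_ge0 ?(ltW t0)//.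
apply: le_trans (UM _ Wf) _; rewrite ler_wpM2l ?sqr_ge0// le_eqVlt; apply/orP; left.
apply/eqP; apply: eq_Rintegral => w _.
by rewrite rnormZ rnorm_real exprMn real_normK ?num_real.
Qed.

Lemma redot_i x y : redot dot (Complex 0 1 *: x) y = - redot dot x (Complex 0 1 *: y).
Proof. by rewrite -Im_dot /redot dotZl; case: (dot x y) => u v /=; lra. Qed.

(** For [h = h1 + i h2] one has [Re <U(h phi), psi> = Re <U(h1 phi), psi> - Re <U(h2 phi), i psi>].
    If [r] and [s] are the real densities for [psi] and [i psi], this is the integral of
    [h1 r - h2 s], the real part of [h (r + i s)]. *)
Lemma operator_density psi : L2 mu psi ->
  exists f : Omega -> R[i]^o, [/\ borel_measurable f,
    mu.-integrable setT (EFin \o (fun w => complex.Re (f w))),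
    mu.-integrable setT (EFin \o (fun w => complex.Im (f w))) &
    forall h, Linfty mu h ->
      \int[mu]_w redot dot (U (fun w => h w *: phi w) w) (psi w) =
      \int[mu]_w complex.Re (h w * f w)].
Proof.
move=> Lpsi.
have Lipsi : L2 mu (fun w => Complex 0 1 *: psi w).
  apply: (L2_Linfty (g := fun=> Complex 0 1) da) => //; split.
    exact: borel_measurable_cst.
  by exists 1; apply: nearW => w; rewrite rnorm_i.
have [r ir rP] := operator_real_density Lpsi.
have [s is_ sP] := operator_real_density Lipsi.
have mr : measurable_fun setT r by exact/measurable_EFinP/(measurable_int _ ir).
have ms : measurable_fun setT s by exact/measurable_EFinP/(measurable_int _ is_).
have mf : borel_measurable (fun w => Complex (r w) (s w) : R[i]^o).
  exact: borel_measurable_complex.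
exists (fun w => Complex (r w) (s w)); split=> // h hL.
have [h1 [h2 [bh1 bh2 hh]]] := Linfty_ReIm hL.
have [W1 W2] := (Wmul bh1, Wmul bh2).
have Wh := mult_invariant_Linfty hL Wphi.
have Wi2 := WZ (Complex 0 1) W2.
have U_eq : {ae mu, forall w, U (fun w => h w *: phi w) w =
    Complex 0 1 *: U (fun w => C (h2 w) *: phi w) w + U (fun w => C (h1 w) *: phi w) w}.
  apply: filterS2 (bounded_operatorDZ (Complex 0 1) W2 W1) (bounded_operator_ae Wh _ _).
  - by move=> w <- ->.
  - exact: (WDZ (Complex 0 1) W2 W1).
  - apply: filterS hh => w ->; rewrite scalerA -scalerDl; congr (_ *: _).
    by apply/eqP; rewrite eq_complex /=; apply/andP; split; apply/eqP; lra.
transitivity (\int[mu]_w (h1 w * r w - h2 w * s w)).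
  rewrite RintegralB//; [|exact: integrable_bounded_mul..].
  rewrite -(rP _ bh1) -(sP _ bh2) -RintegralB//; [|exact: integrable_redot (UL2 _) _..].
  apply: ae_eq_Rintegral.
  - exact: (measurable_redot dotE da (Uborel Wh) (Lpsi.1)).
  - apply: measurable_funB.
      exact: (measurable_redot dotE da (Uborel W1) (Lpsi.1)).
    exact: (measurable_redot dotE da (Uborel W2) (Lipsi.1)).
  - by apply: filterS U_eq => w ->; rewrite redotDl redot_i addrC.
have [mh1 _] := bh1; have [mh2 _] := bh2; have [mh _] := hL.
apply: ae_eq_Rintegral.
- by apply: measurable_funB; exact: measurable_funM.
- exact: measurable_ReM.
- by apply: filterS hh => w ->.
Qed.

End density.

(** * From a determining set to all bounded functions *)

Section determining.
Variable D : set (Omega -> R[i]^o).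
Hypothesis DL : D `<=` Linfty mu.
Hypothesis detD : determining mu D.

Lemma mult_preserving_determining :
  mult_preserving mu D W U -> mult_preserving mu (Linfty mu) W U.
Proof.
move=> UD h phi hL Wphi.
have Wh := mult_invariant_Linfty hL Wphi.
have LhU : L2 mu (fun w => h w *: U phi w) by exact: L2_Linfty da hL (UL2 Wphi).
(* Testing against the defect itself: it will be orthogonal to [psi]. *)
pose psi w := U (fun w => h w *: phi w) w - h w *: U phi w.
have Lpsi : L2 mu psi by exact: L2B da (UL2 Wh) LhU.
have [q dq] := @complex_dense_seq R.
have [f1 [mf1 Ref1 Imf1 f1P]] := operator_density Wphi Lpsi.
pose f2 w : R[i]^o := dot (U phi w) (psi w).
have mf2 : borel_measurable f2.
  exact: (borel_measurable_dot dotE da (Uborel Wphi) (Lpsi.1)).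
have Ref2 : mu.-integrable setT (EFin \o (fun w => complex.Re (f2 w))).
  exact: integrable_redot (UL2 Wphi) Lpsi.
have Imf2 : mu.-integrable setT (EFin \o (fun w => complex.Im (f2 w))).
  have Lipsi : L2 mu (fun w => Complex 0 1 *: psi w).
    apply: (L2_Linfty (g := fun=> Complex 0 1) da) => //; split.
      exact: borel_measurable_cst.
    by exists 1; apply: nearW => w; rewrite rnorm_i.
  apply: eq_integrable (integrable_redot (UL2 Wphi) Lipsi) => //.
  by move=> w _ /=; rewrite Im_dot.
have f2P g : Linfty mu g ->
    {ae mu, forall w, U (fun w => g w *: phi w) w = g w *: U phi w} ->
    \int[mu]_w complex.Re (g w * f1 w) = \int[mu]_w complex.Re (g w * f2 w).
  move=> gL gU; rewrite -f1P//; apply: ae_eq_Rintegral.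
  - have Wg := mult_invariant_Linfty gL Wphi.
    exact: (measurable_redot dotE da (Uborel Wg) (Lpsi.1)).
  - by apply: measurable_ReM => //; have [] := gL.
  - by apply: filterS gU => w ->; rewrite /redot dotZl.
have f12 : {ae mu, forall w, f1 w - f2 w = 0}.
  apply: detD.
    have mf := borel_measurableB dq mf1 mf2; split=> //.
    have Ref := integrableB measurableT Ref1 Ref2.
    have Imf := integrableB measurableT Imf1 Imf2.
    have : mu.-integrable setT (fun w => (rnorm (f1 w - f2 w))%:E).
      apply: (le_integrable measurableT) (integrableD measurableT
        (integrable_abse Ref) (integrable_abse Imf)).
      - exact/measurable_EFinP/borel_measurable_rnorm.
      - move=> w _; rewrite /= lee_fin (ger0_norm (rnorm_ge0 _)).
        rewrite (ger0_norm (addr_ge0 (normr_ge0 _) (normr_ge0 _))).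
        apply: le_trans (rnorm_le_ReIm _) _.
        by case: (f1 w) (f2 w) => ? ? [].
    move=> /integrableP[_]; apply: le_lt_trans; apply: ge0_le_integral => //.
    - by move=> w _; rewrite lee_fin rnorm_ge0.
    - exact/measurable_EFinP/borel_measurable_rnorm.
    - by apply: measurableT_comp => //; exact/measurable_EFinP/borel_measurable_rnorm.
    - by move=> w _; rewrite /= lee_fin ler_norm.
  move=> g Dg; have gL := DL Dg.
  (* Stated for [k] outside [D] as well: it is applied to [g] and to [-i g], whose real parts give
     both components of [Cintegral]. *)
  have Re0 k : Linfty mu k ->
      {ae mu, forall w, U (fun w => k w *: phi w) w = k w *: U phi w} ->
      \int[mu]_w complex.Re (k w * (f1 w - f2 w)) = 0.
    move=> kL kU; transitivity (\int[mu]_w (complex.Re (k w * f1 w) - complex.Re (k w * f2 w))).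
      apply: eq_Rintegral => w _; case: (k w) (f1 w) (f2 w) => ? ? [? ?] [? ?] /=; lra.
    by rewrite RintegralB ?f2P ?subrr//; exact: integrable_ReM.
  have gU := UD g phi Dg Wphi.
  rewrite /Cintegral; apply/eqP; rewrite eq_complex /=; apply/andP; split; apply/eqP.
    by under eq_Rintegral do rewrite mulrC; exact: Re0.
  (* [Im z = Re (-i z)]; the multiplier [-i g] need not lie in [D], but [U] commutes with it because
     [U] is complex linear. *)
  transitivity (\int[mu]_w complex.Re (Complex 0 (-1) * g w * (f1 w - f2 w))).
    apply: eq_Rintegral => w _; case: (g w) (f1 w) (f2 w) => ? ? [? ?] [? ?] /=; lra.
  apply: Re0; first exact: LinftyM.
  have Wg := mult_invariant_Linfty gL Wphi.
  have := bounded_operatorZ (Complex 0 (-1)) Wg.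
  have -> : (fun w => Complex 0 (-1) *: (g w *: phi w)) =
            (fun w => (Complex 0 (-1) * g w) *: phi w).
    by apply/funext => w; rewrite scalerA.
  by apply: filterS2 gU => w -> ->; rewrite scalerA.
(* [|psi|^2 = <U(h phi), psi> - <h U phi, psi>] in real parts; the first term has density [f1] and
   the second [f2], which agree a.e. *)
have psi0 : sqnorm mu psi = 0.
  transitivity (\int[mu]_w (redot dot (U (fun w => h w *: phi w) w) (psi w) -
      redot dot (h w *: U phi w) (psi w))).
    by apply: eq_Rintegral => w _; rewrite -redotNl -redotDl redotxx.
  rewrite RintegralB//; last 2 first.
  - exact: integrable_redot (UL2 Wh) Lpsi.
  - exact: integrable_redot LhU Lpsi.
  apply/eqP; rewrite f1P// subr_eq0; apply/eqP; apply: ae_eq_Rintegral.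
  - by apply: measurable_ReM => //; have [] := hL.
  - exact: (measurable_redot dotE da (LhU.1) (Lpsi.1)).
  - by apply: filterS f12 => w /eqP; rewrite subr_eq0 /redot dotZl => /eqP ->.
apply: filterS (sqnorm_eq0_ae Lpsi psi0) => w /eqP.
by rewrite /psi subr_eq0 => /eqP.
Qed.

End determining.
(** The norm bound for [\1_E phi] compares the integrals over every measurable [E]. The constant is
    unchanged, so [M] can be the operator norm itself, as the norm formula requires. *)
Lemma operator_pointwise_bound (M : R) phi :
  mult_preserving mu (Linfty mu) W U -> 0 <= M ->
  (forall phi, W phi -> sqnorm mu (U phi) <= M ^+ 2 * sqnorm mu phi) ->
  W phi -> {ae mu, forall w, rnorm (U phi w) <= M * rnorm (phi w)}.
Proof.
move=> UL M0 UM Wphi.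
have [mU iU] := (L2P mu _).1 (UL2 Wphi).
have [mphi iphi] := (L2P mu _).1 (WL2 Wphi).
have iMphi : mu.-integrable setT (EFin \o (fun w => M ^+ 2 * rnorm (phi w) ^+ 2)).
  exact: (@integrableZl _ _ _ mu setT measurableT (M ^+ 2) _ iphi).
suff : {ae mu, forall w, rnorm (U phi w) ^+ 2 <= M ^+ 2 * rnorm (phi w) ^+ 2}.
  apply: filterS => w; rewrite -exprMn ler_pXn2r ?nnegrE ?mulr_ge0 ?rnorm_ge0//.
apply: ae_le_of_integral => // E mE.
have bE := bounded_measurable_indic R mE.
have EL := bounded_measurable_Linfty bE.
have WE := mult_invariant_Linfty EL Wphi.
have sqE (f : Omega -> H) : \int[mu]_(w in E) (rnorm (f w) ^+ 2) =
    sqnorm mu (fun w => C (\1_E w) *: f w).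
  rewrite Rintegral_mkcond; apply: eq_Rintegral => w _.
  rewrite patchE indicE rnormZ rnorm_real; case: (_ \in _).
    by rewrite normr1 mul1r.
  by rewrite normr0 mul0r expr0n.
rewrite RintegralZl//; last exact: integrableS iphi.
rewrite !sqE; apply: le_trans (UM _ WE); rewrite le_eqVlt; apply/orP; left; apply/eqP.
apply: ae_eq_Rintegral.
- exact: measurable_sqr_rnorm (L2_Linfty da EL (UL2 Wphi)).1.
- exact: measurable_sqr_rnorm (UL2 WE).1.
- by apply: filterS (UL _ _ EL Wphi) => w ->.
Qed.

Lemma operator_norm_ge0 : (0 <= operator_norm mu W U)%E.
Proof.
have [_ [/set_mem W0 _] _] := cW.
apply: (@le_trans _ _ (L2norm mu (U 0))); first exact: Lnorm_ge0.
apply: ereal_sup_ubound; exists 0 => //; split=> //.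
apply/L2norm_le1; first exact: WL2.
rewrite (ae_sqnorm0 (WL2 W0))//; exact: nearW.
Qed.

Lemma operator_norm_sqnorm (M : R) : 0 <= M -> (operator_norm mu W U <= M%:E)%E ->
  forall phi, W phi -> sqnorm mu (U phi) <= M ^+ 2 * sqnorm mu phi.
Proof.
move=> M0 UM phi Wphi; have [B _ UB] := bounded_operator_sqnorm.
(* A [phi] of norm 0 cannot be normalised; there any bound [B] already forces [U phi] to have norm
   0. *)
have [s0|s0] := eqVneq (sqnorm mu phi) 0.
  by have := UB _ Wphi; rewrite s0 !mulr0.
have sp : 0 < sqnorm mu phi by rewrite lt_def s0 sqnorm_ge0.
set s := sqnorm mu phi in s0 sp *.
pose c := (Num.sqrt s)^-1; pose psi w := C c *: phi w.
have cs : c ^+ 2 = s^-1 by rewrite exprVn sqr_sqrtr// ltW.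
have Wpsi : W psi := WZ (C c) Wphi.
have psi1 : sqnorm mu psi = 1.
  by rewrite (sqnormZ _ (WL2 Wphi)) cs mulVf.
have : (L2norm mu (U psi) <= M%:E)%E.
  apply: le_trans UM; apply: ereal_sup_ubound; exists psi => //; split=> //.
  by apply/L2norm_le1; [exact: WL2|rewrite psi1].
rewrite (L2normE (UL2 Wpsi)) lee_fin => UpsiM.
have : sqnorm mu (U psi) <= M ^+ 2.
  by rewrite -[leLHS]sqr_sqrtr ?sqnorm_ge0// ler_pXn2r ?nnegrE ?sqrtr_ge0.
have -> : sqnorm mu (U psi) = c ^+ 2 * sqnorm mu (U phi).
  rewrite -(sqnormZ _ (UL2 Wphi)); apply: ae_eq_Rintegral.
  - exact: measurable_sqr_rnorm (UL2 Wpsi).1.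
  - apply: measurable_sqr_rnorm; apply: (borel_measurableZ da) (Uborel Wphi).
    exact: borel_measurable_cst.
  - by apply: filterS (bounded_operatorZ (C c) Wphi) => w ->.
by rewrite cs ler_pdivrMl// mulrC.
Qed.

End bounded_operator.

Lemma borel_measurable_orthproj x : borel_measurable (fun w => P w x).
Proof.
by apply: (borel_measurable_weak dotE da) => b; have [[_ mJ] _] := WJ; exact: mJ.
Qed.

(** * Recovering the range operator from countably many elements of [W] *)

Section frame.
Variable eta : Omega -> R.
Hypothesis meta : measurable_fun setT eta.
Hypothesis eta01 : forall w, 0 < eta w <= 1.
Hypothesis ieta : mu.-integrable setT (EFin \o (fun w => eta w ^+ 2)).

Let eta0 w : 0 < eta w. Proof. by have /andP[] := eta01 w. Qed.

Lemma bounded_measurable_eta : bounded_measurable eta.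
Proof.
by split=> //; exists 1 => w; have /andP[e0 e1] := eta01 w; rewrite ger0_norm// ltW.
Qed.

Definition frame n w : H := C (eta w) *: P w (a n).

Lemma frame_mem n : W (frame n).
Proof.
apply/WP; split; last first.
  by apply: nearW => w; exact: closed_subspaceZ (cJ w) _ _ (orthprojS dotE (cJ w) _).
have mC : borel_measurable (fun w => C (eta w) : R[i]^o) by exact: borel_measurable_complex.
have Leta : L2 mu (fun w => C (eta w) : R[i]^o).
  apply/L2P; split=> //; apply: eq_integrable ieta => // w _ /=.
  by rewrite rnorm_real real_normK ?num_real.
have [||//] := @L2_dominated _ _ _ mu _ _ (frame n) (fun w => C (eta w) : R[i]^o) _
  (rnorm_ge0 (a n)) _ Leta.
  by apply: (borel_measurableZ da mC); exact: borel_measurable_orthproj.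
apply: nearW => w; rewrite rnormZ mulrC ler_wpM2r ?rnorm_ge0//.
exact: rnorm_orthproj.
Qed.

Lemma represents_frame U T n : measurable_range_operator mu dot J T ->
  represents mu W U T -> {ae mu, forall w, U (frame n) w = C (eta w) *: T w (P w (a n))}.
Proof.
move=> [blT _] /(_ _ (frame_mem n)); apply: filterS2 blT => w blT ->.
by rewrite (bounded_linear_onZ (cJ w) blT)//; exact: orthprojS.
Qed.

Let etaK w x : C (eta w)^-1 *: (C (eta w) *: x) = x :> H.
Proof. by rewrite scalerA -rmorphM mulVf ?scale1r// gt_eqF. Qed.

Lemma represents_inj U U' T T' : measurable_range_operator mu dot J T ->
  measurable_range_operator mu dot J T' ->
  represents mu W U T -> represents mu W U' T' ->
  eq_operators mu W U U' -> eq_range_operators mu J T T'.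
Proof.
move=> rT rT' UT UT' UU'.
have : {ae mu, forall w, forall n, T w (P w (a n)) = T' w (P w (a n))}.
  apply/ae_foralln => n.
  have := represents_frame n rT' UT'; have := represents_frame n rT UT.
  apply: filterS3 (UU' _ (frame_mem n)) => w -> -> e.
  by rewrite -(etaK w (T w _)) e etaK.
have [blT _] := rT; have [blT' _] := rT'.
apply: filterS3 blT blT' => w blT blT' TT' v Jv.
exact: (bounded_linear_on_eq dotE (cJ w) da blT blT').
Qed.

Lemma represents_opnorm U T (M : R) : 0 <= M ->
  measurable_range_operator mu dot J T -> represents mu W U T ->
  (forall phi, W phi -> {ae mu, forall w, rnorm (U phi w) <= M * rnorm (phi w)}) ->
  {ae mu, forall w, (opnorm_on (J w) (T w) <= M%:E)%E}.
Proof.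
move=> M0 rT UT UM.
have : {ae mu, forall w, forall n, rnorm (T w (P w (a n))) <= M * rnorm (P w (a n))}.
  apply/ae_foralln => n; have := represents_frame n rT UT.
  apply: filterS2 (UM _ (frame_mem n)) => w + Uw.
  rewrite Uw !rnormZ mulrCA ler_pM2l// rnorm_real ger0_norm ?(ltW (eta0 w))//.
have [blT _] := rT.
apply: filterS2 blT => w blT TM.
apply/(opnorm_on_le (cJ w) blT M0).
exact: (bounded_linear_on_dense dotE (cJ w) da).
Qed.

Section construction.
Variables (U : (Omega -> H) -> (Omega -> H)) (M : R) (q : nat -> R[i]^o).
Hypothesis bU : bounded_operator mu W U.
Hypothesis dq : dense_seq q.
Hypothesis M0 : 0 <= M.
Hypothesis UL : mult_preserving mu (Linfty mu) W U.
Hypothesis UM : forall phi, W phi ->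
  {ae mu, forall w, rnorm (U phi w) <= M * rnorm (phi w)}.

Let F n w : H := C (eta w)^-1 *: U (frame n) w.

Let mF n : borel_measurable (F n).
Proof.
have [UL2 _ _ _] := bU; have [mU _] := UL2 _ (frame_mem n).
apply: (borel_measurableZ da) mU; apply: borel_measurable_complex => //=.
exact: measurable_fun_posV.
Qed.

Let F_scale w (x y : H) : rnorm x <= M * rnorm (C (eta w) *: y) ->
  rnorm (C (eta w)^-1 *: x) <= M * rnorm y.
Proof.
have ei : 0 < (eta w)^-1 by rewrite invr_gt0.
by rewrite !rnormZ !rnorm_real !gtr0_norm// mulrCA ler_pdivrMl.
Qed.

Let FB : {ae mu, forall w, forall n m,
  rnorm (F n w - F m w) <= M * rnorm (P w (a n) - P w (a m))}.
Proof.
apply/ae_foralln => n; apply/ae_foralln => m.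
have [Wn Wm] := (frame_mem n, frame_mem m).
apply: filterS2 (UM (WB Wn Wm)) (bounded_operatorB bU Wn Wm) => w + Uw.
by rewrite Uw /F -scalerBr /frame -scalerBr; exact: F_scale.
Qed.

(** The factor [eta w] comes out of linear combinations, so the pointwise bound for combinations of
    frame elements can be divided by it. Scalars range over the sequence [q] so that countably many
    null sets suffice. *)
Let FDZ : {ae mu, forall w, forall k j n m,
  rnorm (F k w - (q j *: F n w + F m w)) <=
  M * rnorm (P w (a k) - ((q j : R[i]) *: P w (a n) + P w (a m)))}.
Proof.
apply/ae_foralln => k; apply/ae_foralln => j; apply/ae_foralln => n; apply/ae_foralln => m.
have [Wk Wn Wm] := And3 (frame_mem k) (frame_mem n) (frame_mem m).
have Wnm : W (fun w => q j *: frame n w + frame m w) by exact: (WDZ (q j) Wn Wm).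
apply: filterS3 (UM (WB Wk Wnm)) (bounded_operatorB bU Wk Wnm)
  (bounded_operatorDZ bU (q j) Wn Wm) => w + Uw Uw'.
have scale_lin (c z : R[i]) (x y t : H) : c *: x - (z *: (c *: y) + c *: t) =
    c *: (x - (z *: y + t)).
  by rewrite scalerBr scalerDr !scalerA (mulrC c).
by rewrite Uw Uw' /F /frame !scale_lin; exact: F_scale.
Qed.

Lemma range_operator_exists :
  exists2 T, measurable_range_operator mu dot J T & represents mu W U T.
Proof.
have [N [mN N0 NP]] := ae_measurable_null (filterI FB FDZ).
have ext w : ~ N w -> (forall n m, rnorm (F n w - F m w) <= M * rnorm (P w (a n) - P w (a m)))
    /\ forall k j n m, rnorm (F k w - (q j *: F n w + F m w)) <=
      M * rnorm (P w (a k) - ((q j : R[i]) *: P w (a n) + P w (a m))).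
  by move=> /NP.
(* The value 0 on [N] makes the Lipschitz comparison in the measurability proof hold at every [w],
   not just almost everywhere. *)
pose T w v : H := if w \in N then 0 else dense_ext dot (J w) a (F^~ w) M v.
exists T.
  split.
    apply: filterS (null_ae mN N0) => w Nw; have [FBw FDZw] := ext w Nw.
    rewrite /T memNset//.
    exact: (dense_ext_bounded_linear dotE (cJ w) da dq M0 FBw FDZw).
  move=> x b; apply: (borel_measurable_dot dotE da); last exact: borel_measurable_cst.
  (* Off [N], the map [x |-> T w (P w x)] differs from [F n w] by at most [M |x - a n|], projections
     being contractions. *)
  apply: (borel_measurable_lip da (b := a)
    (F := fun n w => if w \in N then 0 else F n w) (g := fun=> x) (M := M)) => //.
  - by move=> n; exact: borel_measurable_if.
  - exact: borel_measurable_cst.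
  move=> n w; rewrite /T; case: ifPn => [_|/negP Nw].
    by rewrite subr0 rnorm0 mulr_ge0 ?rnorm_ge0.
  have [|FBw FDZw] := ext w; first by move=> h; apply: Nw; exact: mem_set.
  apply: le_trans (dense_extP dotE (cJ w) da M0 FBw n (orthprojS dotE (cJ w) x)) _.
  by rewrite ler_wpM2l// orthproj_lip.
move=> phi Wphi; have [_ phiJ] := (WP phi).1 Wphi.
have eL := bounded_measurable_Linfty bounded_measurable_eta.
have We := mult_invariant_Linfty eL Wphi.
(* Since [eta phi - frame n] lies in [W], the bound for [U] applies to it; dividing by [eta w] gives
   the inequalities that characterise the extension at [phi w]. *)
have near_F : {ae mu, forall w, forall n,
    rnorm (U phi w - F n w) <= M * rnorm (phi w - P w (a n))}.
  apply/ae_foralln => n; have Wn := frame_mem n.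
  apply: filterS3 (UM (WB We Wn)) (bounded_operatorB bU We Wn) (UL eL Wphi) => w + Uw Uw'.
  rewrite Uw Uw' /frame -scalerBr => /F_scale.
  by rewrite scalerBr etaK.
apply: filterS3 (null_ae mN N0) phiJ near_F => w Nw Jw Fw; have [FBw FDZw] := ext w Nw.
rewrite /T memNset//.
exact: (dense_ext_unique dotE (cJ w) da M0 FBw Jw).
Qed.

End construction.
End frame.

(** Only linearity of [T w] at almost every point is involved, so [E] is left general: it serves for
    [D] and for [Linfty]. *)
Lemma represents_mult_preserving E U T : measurable_range_operator mu dot J T ->
  represents mu W U T -> (forall g phi, E g -> W phi -> W (fun w => g w *: phi w)) ->
  mult_preserving mu E W U.
Proof.
move=> [blT _] UT WE g phi Eg Wphi; have [_ phiJ] := (WP phi).1 Wphi.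
have := UT _ Wphi; have := UT _ (WE _ _ Eg Wphi).
move=> h1 h2; apply: filterS2 (filterI h1 h2) (filterI blT phiJ) => w [-> ->] [blw Jw].
by rewrite (bounded_linear_onZ (cJ w) blw).
Qed.

Lemma eq_range_operators_represents U U' T T' :
  represents mu W U T -> represents mu W U' T' ->
  eq_range_operators mu J T T' -> eq_operators mu W U U'.
Proof.
move=> UT UT' TT' phi Wphi; have [_ phiJ] := (WP phi).1 Wphi.
apply: filterS2 (filterI (UT _ Wphi) (UT' _ Wphi)) (filterI TT' phiJ) => w [-> ->] [TT'w Jw].
exact: TT'w.
Qed.

(** * From an essentially bounded range operator to an operator on [W] *)

Section operator_of_range_operator.
Variables (T : Omega -> H -> H) (M : R).
Hypothesis M0 : 0 <= M.
Hypothesis rT : measurable_range_operator mu dot J T.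
Hypothesis TM : {ae mu, forall w, (opnorm_on (J w) (T w) <= M%:E)%E}.

Lemma operator_of_range_operator : exists2 U, bounded_operator mu W U & represents mu W U T.
Proof.
have [blT mT] := rT.
have [N [mN N0 NP]] := ae_measurable_null (filterI blT TM).
have Tbound w v : ~ N w -> J w v -> rnorm (T w v) <= M * rnorm v.
  by move=> /NP[blw /(opnorm_on_le (cJ w) blw M0)]; exact.
(* Projecting onto [J w] makes the formula meaningful for all [w] outside a null set
   that does not depend on [phi]. *)
pose U phi w : H := if w \in N then 0 else T w (P w (phi w)).
have Ule phi w : rnorm (U phi w) <= M * rnorm (phi w).
  rewrite /U; case: ifPn => [_|/negP Nw]; first by rewrite rnorm0 mulr_ge0 ?rnorm_ge0.
  have {}Nw : ~ N w by move=> h; apply: Nw; exact: mem_set.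
  apply: le_trans (Tbound _ _ Nw (orthprojS dotE (cJ w) _)) _.
  by rewrite ler_wpM2l// rnorm_orthproj.
have UDZ (z : R[i]) phi psi w : U (z *: phi + psi) w = z *: U phi w + U psi w.
  rewrite /U; case: ifPn => [_|/negP Nw]; first by rewrite scaler0 addr0.
  have /NP[[Tlin _] _] : ~ N w by move=> h; apply: Nw; exact: mem_set.
  rewrite -Tlin; [|exact: orthprojS..].
  by congr T; exact: orthprojDZ.
have mU phi : borel_measurable phi -> borel_measurable (U phi).
  move=> mphi; apply: (borel_measurable_lip da (b := a) (g := phi) (M := M)
    (F := fun n w => if w \in N then 0 else T w (P w (a n)))) => //.
    move=> n; apply: (borel_measurable_weak dotE da) => b.
    rewrite (_ : (fun w => _) =
        (fun w => if w \in N then 0 else dot (T w (P w (a n))) b : R[i]^o)).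
      by apply: borel_measurable_if => //; exact: mT.
    by apply/funext => w; case: ifP => // _; rewrite dot0l.
  (* The formula for [U] makes sense for all functions, so it may be applied to [phi - a n] with a
     constant vector, which need not lie in [W]; [Ule] then gives the Lipschitz bound. *)
  move=> n w; have -> : U phi w - (if w \in N then 0 else T w (P w (a n))) =
      U (fun w => phi w - a n) w.
    rewrite /U; case: ifPn => [_|/negP Nw]; first by rewrite subr0.
    have /NP[blw _] : ~ N w by move=> h; apply: Nw; exact: mem_set.
    rewrite (orthprojB dotE (cJ w)) (bounded_linear_onB blw)//; exact: orthprojS.
  exact: Ule.
have UL2 phi : W phi -> L2 mu (U phi) /\ sqnorm mu (U phi) <= M ^+ 2 * sqnorm mu phi.
  move=> Wphi; apply: L2_dominated => //; first exact/mU/Wborel.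
    exact: WL2.
  by apply: nearW => w; exact: Ule.
exists U.
  split.
  - by move=> phi /UL2[].
  - by move=> phi psi _ _; apply: filterS => w; rewrite /U => ->.
  - by move=> z phi psi _ _; apply: nearW => w; exact: UDZ.
  - exists M => phi Wphi; have [LU sU] := UL2 _ Wphi.
    by apply/L2norm_le => //; exact: WL2.
move=> phi Wphi; have [_ phiJ] := (WP phi).1 Wphi.
apply: filterS2 (null_ae mN N0) phiJ => w Nw Jw.
by rewrite /U memNset// (orthproj_id dotE (cJ w)).
Qed.

End operator_of_range_operator.

(** * Equality of the two norms *)

Lemma opnorm_on_ge0 (T : Omega -> H -> H) w :
  bounded_linear_on (J w) (T w) -> (0 <= opnorm_on (J w) (T w))%E.
Proof.
move=> blw; apply: ereal_sup_ubound; exists 0; last first.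
  by rewrite (bounded_linear_on0 (cJ w) blw) rnorm0.
by split; [exact: closed_subspace0 (cJ w)|rewrite rnorm0].
Qed.

(** Operator norms are nonnegative a.e., so the absolute value inside [Lnorm] is harmless; when [mu]
    is zero, both sides hold trivially. *)
Lemma ess_sup_opnorm_le (T : Omega -> H -> H) (M : R) : 0 <= M ->
  measurable_range_operator mu dot J T ->
  (ess_sup_opnorm mu J T <= M%:E)%E <-> {ae mu, forall w, (opnorm_on (J w) (T w) <= M%:E)%E}.
Proof.
move=> M0 [blT _]; rewrite /ess_sup_opnorm unlock; case: ifPn => [mu0|mu0].
  split=> [/ess_supP|] h; last apply/ess_supP.
    by apply: filterS h => w; apply: le_trans; rewrite lee_abs.
  by apply: filterS2 blT h => w blw /=; rewrite gee0_abs// opnorm_on_ge0.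
split=> // _; exists setT; split=> //.
by apply/eqP; rewrite eq_le measure_ge0 andbT leNgt.
Qed.

Lemma operator_norm_eq U T : bounded_operator mu W U -> measurable_range_operator mu dot J T ->
  represents mu W U T -> operator_norm mu W U = ess_sup_opnorm mu J T.
Proof.
move=> bU rT UT; apply/eqP; rewrite eq_le; apply/andP; split.
  have : (0 <= ess_sup_opnorm mu J T)%E by exact: Lnorm_ge0.
  (* Each inequality is proved with the other side as a real constant [M]: [+oo] is trivial and
     [-oo] is excluded by nonnegativity. *)
  case E : (ess_sup_opnorm mu J T) => [M| |//]; last by move=> _; exact: leey.
  rewrite lee_fin => M0.
  have /(ess_sup_opnorm_le M0 rT) TM : (ess_sup_opnorm mu J T <= M%:E)%E by rewrite E.
  apply: ge_ereal_sup => _ [phi [Wphi phi1] <-].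
  have [_ phiJ] := (WP phi).1 Wphi; have [blT _] := rT; have [UL2 _ _ _] := bU.
  have LU := UL2 _ Wphi.
  have [|_ sU] := L2_dominated M0 LU.1 (WL2 Wphi).
    apply: filterS3 (filterI TM blT) phiJ (UT _ Wphi) => w [TMw blw] Jw ->.
    by move/(opnorm_on_le (cJ w) blw M0): TMw; apply.
  have := (L2norm_le M0 LU (WL2 Wphi)).2 sU; move=> /le_trans; apply.
  by rewrite -[leRHS]mule1; apply: lee_wpmul2l.
have : (0 <= operator_norm mu W U)%E by exact: operator_norm_ge0.
case E : (operator_norm mu W U) => [M| |//]; last by move=> _; exact: leey.
rewrite lee_fin => M0; apply/ess_sup_opnorm_le => //.
have UM : (operator_norm mu W U <= M%:E)%E by rewrite E.
have UL : mult_preserving mu (Linfty mu) W U.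
  by apply: represents_mult_preserving rT UT _ => g phi; exact: mult_invariant_Linfty.
have [eta [meta eta01 ieta]] := sigma_finite_density mu.
apply: (represents_opnorm meta eta01 ieta M0 rT UT) => phi Wphi.
exact: (operator_pointwise_bound bU UL M0 (operator_norm_sqnorm bU M0 UM)).
Qed.

End operators.

Theorem theorem2p2 (R : realType) (d : measure_display)
    (Omega : measurableType d)
    (mu : {sigma_finite_measure set Omega -> \bar R})
    (H : completeNormedModType R[i]) (dot : {dot H for @Num.conj R[i]})
    (D : set (Omega -> R[i]^o)) (W : set (Omega -> H)) (J : Omega -> set H) :
  L2_separable mu ->
  induces_norm dot ->
  separable H ->
  D `<=` Linfty mu ->
  determining mu D ->
  mult_invariant mu D W ->
  corresponding_range_function mu dot W J ->
  [/\ (forall U, bounded_operator mu W U ->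
         [<-> mult_preserving mu D W U;
              mult_preserving mu (Linfty mu) W U;
              exists2 T, measurable_range_operator mu dot J T &
                         represents mu W U T]),
      (forall T, measurable_range_operator mu dot J T ->
         (ess_sup_opnorm mu J T < +oo)%E ->
         exists U, [/\ bounded_operator mu W U, mult_preserving mu D W U &
                       represents mu W U T]),
      (forall U U' T T',
         bounded_operator mu W U -> bounded_operator mu W U' ->
         mult_preserving mu D W U -> mult_preserving mu D W U' ->
         measurable_range_operator mu dot J T ->
         measurable_range_operator mu dot J T' ->
         represents mu W U T -> represents mu W U' T' ->
         (eq_operators mu W U U' <-> eq_range_operators mu J T T')) &
      (forall U T,
         bounded_operator mu W U -> mult_preserving mu D W U ->
         measurable_range_operator mu dot J T ->
         represents mu W U T ->
         operator_norm mu W U = ess_sup_opnorm mu J T)].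

Proof.
move=> _ dotE sepH DL detD [cW WD] WJ.
have [a da] := separable_dense_seq sepH.
have [eta [meta eta01 ieta]] := sigma_finite_density mu.
have [q dq] := @complex_dense_seq R.
split.
- move=> U bU; split; first exact: (mult_preserving_determining dotE da cW WJ bU DL detD).
  split=> [UL|[T rT UT]].
    have [M M0 UM] := bounded_operator_sqnorm WJ bU.
    apply: (range_operator_exists dotE da cW WJ meta eta01 ieta bU dq M0 UL) => phi.
    exact: (operator_pointwise_bound da WJ bU UL M0 UM).
  (* The cycle closes with (3) => (1), by invariance of [W] under [D]. *)
  by apply: (represents_mult_preserving WJ rT UT) => g phi; exact: WD.
- move=> T rT Tfin.
  have T0 : (0 <= ess_sup_opnorm mu J T)%E by exact: Lnorm_ge0.
  have Tfin' : ess_sup_opnorm mu J T \is a fin_num by rewrite ge0_fin_numE.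
  pose M := fine (ess_sup_opnorm mu J T); have M0 : 0 <= M by exact: fine_ge0.
  have TM : (ess_sup_opnorm mu J T <= M%:E)%E by rewrite fineK.
  have [U bU UT] := operator_of_range_operator dotE da WJ M0 rT
    ((ess_sup_opnorm_le WJ M0 rT).1 TM).
  exists U; split=> //.
  by apply: (represents_mult_preserving WJ rT UT) => g phi; exact: WD.
- move=> U U' T T' _ _ _ _ rT rT' UT UT'; split.
    exact: (represents_inj dotE da WJ meta eta01 ieta rT rT' UT UT').
  exact: (eq_range_operators_represents WJ UT UT').
- by move=> U T bU _ rT UT; exact: (operator_norm_eq dotE da cW WJ bU rT UT).
Qed.
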